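(* Let $X,Y$ be uniform spaces and $G$ an internal abelian group. If two S-continuous maps $f,g:{}^{\ast}X\to{}^{\ast}Y$ are S-homotopic, then the induced chain maps $M_\bullet(f;G),M_\bullet(g;G):M_\bullet(X;G)\to M_\bullet(Y;G)$ are chain homotopic; hence $H_\bullet(f;G)=H_\bullet(g;G)$. The same holds in the relative case: if $A\subseteq X$, $B\subseteq Y$ and $f,g:({}^{\ast}X,{}^{\ast}A)\to({}^{\ast}Y,{}^{\ast}B)$ are S-continuous maps of pairs that are S-homotopic as maps of pairs, then the induced chain maps $M_\bullet(X,A;G)\to M_\bullet(Y,B;G)$ are chain homotopic, and hence the induced maps $H_\bullet(X,A;G)\to H_\bullet(Y,B;G)$ are equal.
   Context: Nonstandard setting: fix a standard universe $\mathbb{U}$ satisfying sufficiently many axioms of ZFC and containing all standard objects considered (uniform spaces are standard), and an elementary extension ${}^{\ast}\mathbb{U}$ of $\mathbb{U}$ (the internal universe) that is $|\mathbb{U}|^{+}$-saturated; $x\mapsto{}^{\ast}x$ is the elementary embedding. ''Internal'' means belonging to ${}^{\ast}\mathbb{U}$; ''hyperfinite'' means finite in the sense of ${}^{\ast}\mathbb{U}$. For a uniform space $X$, points $x,y\in{}^{\ast}X$ are infinitely close, $x\approx y$, if $(x,y)\in{}^{\ast}U$ for every entourage $U$ of $X$. Subsets of uniform spaces carry the subspace uniformity, and products the product uniformity. S-continuity: an internal map $f:{}^{\ast}X\to{}^{\ast}Y$ is S-continuous at $x\in{}^{\ast}X$ if $f(y)\approx f(x)$ for all $y\approx x$; it is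 S-continuous if it is so at every $x\in{}^{\ast}X$. S-continuous maps $f,g:{}^{\ast}X\to{}^{\ast}Y$ are S-homotopic if there is an S-continuous map $h:{}^{\ast}X\times{}^{\ast}[0,1]\to{}^{\ast}Y$ (where ${}^{\ast}X\times{}^{\ast}[0,1]={}^{\ast}(X\times[0,1])$, $[0,1]$ with its usual uniformity) with $h(\cdot,0)=f$ and $h(\cdot,1)=g$. A map of pairs $f:({}^{\ast}X,{}^{\ast}A)\to({}^{\ast}Y,{}^{\ast}B)$ is one with $f({}^{\ast}A)\subseteq{}^{\ast}B$, and two such are S-homotopic as maps of pairs if there is an S-homotopy $h$ with $h({}^{\ast}A\times{}^{\ast}[0,1])\subseteq{}^{\ast}B$. $\mu$-homology: $C_p(X;G)$ is the internal abelian group of hyperfinite formal sums $\sum_{i=0}^{n}g_i\sigma_i$ with $\{g_i\}_{i=0}^n$ and $\{\sigma_i\}_{i=0}^n$ internal hyperfinite sequences in $G$ and in ${}^{\ast}X^{p+1}$ respectively (equivalently, internal functions ${}^{\ast}X^{p+1}\to G$ with hyperfinite support). A $p$-microsimplex is $(a_0,\ldots,a_p)\in{}^{\ast}X^{p+1}$ with $a_i\approx a_j$ for all $i,j\le p$. $M_p(X;G)\subseteq C_p(X;G)$ is the subgroup of $p$-microchains, i.e. elements representable as $\sum_{i=0}^n g_i\sigma_i$ with $\{g_i\}$, $\{\sigma_i\}$ internal hyperfinite sequences and every $\sigma_i$ a $p$-microsimplex; $M_p=0$ for $p<0$. The boundary $\partial_p:M_p(X;G)\to M_{p-1}(X;G)$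 is the restriction of the internal homomorphism determined by $\partial_p(a_0,\ldots,a_p)=\sum_{i=0}^p(-1)^i(a_0,\ldots,\hat a_i,\ldots,a_p)$ ($\partial_0=0$). $H_\bullet(X;G)$ is the homology of $M_\bullet(X;G)$. For $A\subseteq X$, $M_\bullet(A;G)$ is identified with a subcomplex of $M_\bullet(X;G)$ via the map induced by inclusion, $M_\bullet(X,A;G)=M_\bullet(X;G)/M_\bullet(A;G)$, and $H_\bullet(X,A;G)$ is its homology. An S-continuous map $f:{}^{\ast}X\to{}^{\ast}Y$ induces a chain map $M_\bullet(f;G)$, determined by $(a_0,\ldots,a_p)\mapsto(f(a_0),\ldots,f(a_p))$ and extended to hyperfinite sums, with induced map $H_\bullet(f;G)$ on homology; likewise for maps of pairs. *)

(* Defs.v *)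
From HB Require Import structures.
From mathcomp Require Import all_boot all_order all_algebra.
From mathcomp Require Import all_classical all_reals all_analysis.
From mathcomp Require Import zify.
Set Implicit Arguments.
Unset Strict Implicit.
Unset Printing Implicit Defensive.
Import Order.TTheory GRing.Theory Num.Theory.
Import numFieldNormedType.Exports.
Local Open Scope classical_set_scope.
Local Open Scope ring_scope.

(** Chain complexes of abelian groups in degrees [p >= 0], all groups of negative
    degree being 0: every element of degree 0 is a cycle, and the component
    [C 0 -> D 1] of a chain homotopy satisfies the equation without the term
    [h o bdry]. *)

Section QuotientMap.
Context (V W : zmodType) (S : zmodClosed V) (T : zmodClosed W).
Context (f : {additive V -> W}) (fST : forall x, x \in S -> f x \in T).
Local Open Scope quotient_scope.

Definition quot_map (x : Quotient.quot S) : Quotient.quot T :=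
  \pi_(Quotient.quot T) (f (repr x)).

Lemma quot_mapE (x : V) :
  quot_map (\pi_(Quotient.quot S) x) = \pi_(Quotient.quot T) (f x).
Proof.
apply/eqP; rewrite /quot_map -Quotient.idealrBE -raddfB; apply: fST.
by rewrite Quotient.idealrBE reprK.
Qed.

Lemma quot_map_is_zmod_morphism : zmod_morphism quot_map.
Proof.
move=> x y; rewrite -[x]reprK -[y]reprK -raddfB !quot_mapE.
by rewrite (raddfB f) (raddfB (\pi_(Quotient.quot T))).
Qed.

Definition quot_mapA : {additive Quotient.quot S -> Quotient.quot T} :=
  HB.pack quot_map (GRing.isZmodMorphism.Build _ _ quot_map
                      quot_map_is_zmod_morphism).

End QuotientMap.

Record chain_complex := ChainComplex {
  chain_obj :> nat -> zmodType;
  bdry : forall p, {additive chain_obj p.+1 -> chain_obj p};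
  bdry_bdry : forall p (c : chain_obj p.+2), bdry p (bdry p.+1 c) = 0 }.
Arguments bdry C {p} : rename.

Record chain_map (C D : chain_complex) := ChainMap {
  chain_fun :> forall p, {additive C p -> D p};
  chain_fun_bdry : forall p (c : C p.+1),
    chain_fun p (bdry C c) = bdry D (chain_fun p.+1 c) }.

Definition chain_homotopic (C D : chain_complex) (f g : chain_map C D) : Prop :=
  exists h : forall p, {additive C p -> D p.+1},
    (forall c : C 0%N, g 0%N c - f 0%N c = bdry D (h 0%N c)) /\
    (forall p (c : C p.+1),
       g p.+1 c - f p.+1 c = bdry D (h p.+1 c) + h p (bdry C c)).

Section Homology.
Context (C : chain_complex).

Definition cycles p : {pred C p} :=
  match p with
  | 0%N => fun=> true
  | q.+1 => fun c => bdry C c == 0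
  end.

Lemma cycles_zmod_closed p : zmod_closed (@cycles p).
Proof.
case: p => [|p]; first by split.
split; rewrite ?unfold_in /=; first by rewrite raddf0.
by move=> x y; rewrite !unfold_in /= raddfB => /eqP-> /eqP->; rewrite subr0.
Qed.
HB.instance Definition _ p :=
  GRing.isZmodClosed.Build (C p) (@cycles p) (@cycles_zmod_closed p).

Record cycle_group p := Cycle { cycle_val :> C p; _ : cycles cycle_val }.
HB.instance Definition _ p := [isSub for @cycle_val p].
HB.instance Definition _ p := [Choice of cycle_group p by <:].
HB.instance Definition _ p := [SubChoice_isSubZmodule of cycle_group p by <:].

Definition boundaries p : {pred cycle_group p} :=
  fun z => `[< exists b : C p.+1, cycle_val z = bdry C b >].

Lemma boundaries_zmod_closed p : zmod_closed (@boundaries p).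
Proof.
split; first by apply/asboolP; exists 0; rewrite !raddf0.
move=> x y /asboolP[a xa] /asboolP[b yb]; apply/asboolP; exists (a - b).
by rewrite raddfB -xa -yb.
Qed.
HB.instance Definition _ p :=
  GRing.isZmodClosed.Build (cycle_group p) (@boundaries p) (@boundaries_zmod_closed p).

Definition homology p : zmodType := Quotient.quot (@boundaries p).

End Homology.

Section HomologyMap.
Context (C D : chain_complex) (f : chain_map C D) (p : nat).

Lemma chain_fun_cycle (z : cycle_group C p) : cycles (f p (cycle_val z)).
Proof.
case: p z => [//|q] [z zc] /=.
by rewrite -chain_fun_bdry (eqP zc) raddf0.
Qed.

Definition cycle_fun (z : cycle_group C p) : cycle_group D p :=
  Cycle (chain_fun_cycle z).

Lemma cycle_fun_is_zmod_morphism : zmod_morphism cycle_fun.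
Proof. by move=> x y; apply: val_inj; rewrite /= !raddfB. Qed.
HB.instance Definition _ :=
  GRing.isZmodMorphism.Build _ _ cycle_fun cycle_fun_is_zmod_morphism.

Lemma cycle_fun_boundaries z :
  z \in @boundaries C p -> cycle_fun z \in @boundaries D p.
Proof.
move=> /asboolP[b zb]; apply/asboolP; exists (f p.+1 b).
by rewrite /= zb chain_fun_bdry.
Qed.

Definition homology_map : {additive homology C p -> homology D p} :=
  quot_mapA cycle_fun_boundaries.

End HomologyMap.

Record subcomplex (C : chain_complex) := Subcomplex {
  subcx :> forall p, zmodClosed (C p);
  subcx_bdry : forall p (c : C p.+1), c \in subcx p.+1 -> bdry C c \in subcx p }.

Section QuotientComplex.
Context (C : chain_complex) (S : subcomplex C).
Local Open Scope quotient_scope.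

Definition quot_bdry p := quot_mapA (@subcx_bdry C S p).

Lemma quot_bdry_bdry p (c : Quotient.quot (S p.+2)) :
  quot_bdry p (quot_bdry p.+1 c) = 0.
Proof.
rewrite -[c]reprK /quot_bdry /= !quot_mapE; do ?exact: subcx_bdry.
by rewrite bdry_bdry raddf0.
Qed.

Definition quotient_complex : chain_complex :=
  ChainComplex quot_bdry_bdry.

End QuotientComplex.

Section QuotientChainMap.
Context (C D : chain_complex) (S : subcomplex C) (T : subcomplex D).
Context (f : chain_map C D) (fST : forall p c, c \in S p -> f p c \in T p).

Lemma quot_chain_fun_bdry p (c : quotient_complex S p.+1) :
  quot_mapA (@fST p) (bdry _ c) = bdry (quotient_complex T) (quot_mapA (@fST p.+1) c).
Proof.
rewrite -[c]reprK /= !quot_mapE; do ?exact: subcx_bdry; do ?exact: fST.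
by rewrite chain_fun_bdry.
Qed.

Definition quotient_chain_map :
  chain_map (quotient_complex S) (quotient_complex T) :=
  @ChainMap (quotient_complex S) (quotient_complex T)
    (fun p => quot_mapA (@fST p)) quot_chain_fun_bdry.

End QuotientChainMap.

(** A structure for the language of set theory. Its elements are the sets of a
    universe, with [memb] as membership relation. *)
Record sets := Sets { sets_sort :> Type; memb : sets_sort -> sets_sort -> Prop }.
Arguments memb {s}.
Notation "x ∈ A" := (memb x A) (at level 70).

(** First-order formulas of set theory, with de Bruijn indices. *)
Inductive formula :=
| fmem of nat & nat
| feq of nat & nat
| fbot
| fimp of formula & formula
| fall of formula.

Definition push_env (S : Type) (x : S) (e : nat -> S) (n : nat) : S :=
  if n is m.+1 then e m else x.

Fixpoint sat (S : sets) (e : nat -> S) (phi : formula) : Prop :=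
  match phi with
  | fmem i j => e i ∈ e j
  | feq i j => e i = e j
  | fbot => False
  | fimp a b => sat e a -> sat e b
  | fall a => forall x : S, sat (push_env x e) a
  end.

(** Set-theoretic notions read inside a structure [S]; in the internal universe
    they are the internal notions, e.g. [is_nat] is being a hypernatural number
    and [is_zmod] is being an internal abelian group. Pairs are Kuratowski's,
    natural numbers are von Neumann's. *)
Section SetLanguage.
Context (S : sets).
Implicit Types (x y z A B C f n m G a P : S).

Definition is_empty z := forall x, ~ x ∈ z.
Definition is_succ n m := forall x, x ∈ m <-> x ∈ n \/ x = n.
Definition is_upair x y z := forall u, u ∈ z <-> u = x \/ u = y.
Definition is_opair x y z :=
  exists u v, is_upair x x u /\ is_upair x y v /\ is_upair u v z.
Definition is_prod A B C := forall z,
  z ∈ C <-> exists x y, x ∈ A /\ y ∈ B /\ is_opair x y z.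

Definition maps f x y := exists z, is_opair x y z /\ z ∈ f.
Definition is_fun f A B :=
  (forall z, z ∈ f -> exists x y, x ∈ A /\ y ∈ B /\ is_opair x y z) /\
  (forall x, x ∈ A -> exists y, maps f x y) /\
  (forall x y z, maps f x y -> maps f x z -> y = z).

Definition is_inductive A :=
  (forall z, is_empty z -> z ∈ A) /\
  (forall n m, n ∈ A -> is_succ n m -> m ∈ A).
Definition is_nat n := forall A, is_inductive A -> n ∈ A.

(** [binop a x y z]: [z] is the value at [(x, y)] of the binary operation [a]. *)
Definition binop a x y z := exists p, is_opair x y p /\ maps a p z.
Definition is_zero G a z := z ∈ G /\ forall x, x ∈ G -> binop a z x x.
Definition is_zmod G a :=
  (exists P, is_prod G G P /\ is_fun a P G) /\
  (forall x y z u v w, binop a x y u -> binop a u z v ->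
     binop a y z w -> binop a x w v) /\
  (forall x y z, binop a x y z -> binop a y x z) /\
  (exists z, is_zero G a z /\
     forall x, x ∈ G -> exists y, y ∈ G /\ binop a x y z).

(** [r] is the sum in the abelian group [(G, a)] of the values [y] determined by
    [u i y], for [i] in [n = {0, ..., n - 1}]; [P : n + 1 -> G] is the sequence of
    partial sums. *)
Definition is_sum G a n (u : S -> S -> Prop) r :=
  exists m P, is_succ n m /\ is_fun P m G /\
    (forall i z, is_empty i -> is_zero G a z -> maps P i z) /\
    (forall i j x y z, i ∈ n -> is_succ i j ->
       maps P i x -> u i y -> binop a x y z -> maps P j z) /\
    maps P n r.

(** The function [c : A -> G] is the formal sum of the [g_i s_i] for [i < n], where
    [g : n -> G] and [s : n -> A]: its value at [t] is the sum over [i < n] of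
    [coef i], which is [g_i] if [s_i = t] and 0 otherwise. *)
Definition coef G a g s t : S -> S -> Prop := fun i y =>
  exists x, maps s i x /\ (x = t /\ maps g i y \/ x <> t /\ is_zero G a y).
Definition formal_sum G a A n g s c :=
  is_nat n /\ is_fun g n G /\ is_fun s n A /\ is_fun c A G /\
  forall t y, maps c t y -> is_sum G a n (coef G a g s t) y.

End SetLanguage.

(** The standard universe contains all subsets of its elements (separation is not
    restricted to definable properties), so that every mathematical object over
    one of its elements is again one of its elements. With Rocq's own choice
    principle, the axiom of choice follows. Replacement and foundation are not
    needed. *)
Record standard_universe (S : sets) : Prop := StandardUniverse {
  su_ext : forall A B : S, (forall x, x ∈ A <-> x ∈ B) -> A = B;
  su_pair : forall x y : S, exists z, is_upair x y z;
  su_union : forall A : S, exists B,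
    forall x, x ∈ B <-> exists y, y ∈ A /\ x ∈ y;
  su_power : forall A : S, exists B,
    forall C, C ∈ B <-> (forall x, x ∈ C -> x ∈ A);
  su_infinity : exists A : S, is_inductive A;
  su_separation : forall (A : S) (P : S -> Prop), exists B,
    forall x, x ∈ B <-> x ∈ A /\ P x }.

Definition definable (P : forall S : sets, (nat -> S) -> Prop) : Prop :=
  exists phi, forall (S : sets) (e : nat -> S), sat e phi <-> P S e.

Lemma def_mem i j : definable (fun S e => e i ∈ e j).
Proof. by exists (fmem i j). Qed.
Lemma def_eq i j : definable (fun S e => e i = e j).
Proof. by exists (feq i j). Qed.
Lemma def_imp A B : definable A -> definable B ->
  definable (fun S e => A S e -> B S e).
Proof.
move=> [a aP] [b bP]; exists (fimp a b) => S e /=.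
by split=> h /aP /h /bP.
Qed.
Lemma def_not A : definable A -> definable (fun S e => ~ A S e).
Proof. by move=> dA; apply: def_imp => //; exists fbot. Qed.
Lemma def_and A B : definable A -> definable B ->
  definable (fun S e => A S e /\ B S e).
Proof.
move=> dA dB; have [f fP] := def_not (def_imp dA (def_not dB)).
exists f => S e; rewrite fP; split; last by move=> [? ?] h; exact: h.
by move=> h; split; apply: contrapT => k; apply: h.
Qed.
Lemma def_or A B : definable A -> definable B ->
  definable (fun S e => A S e \/ B S e).
Proof.
move=> /def_not dA dB; have [f fP] := def_imp dA dB.
exists f => S e; rewrite fP; split; last tauto.
by have [] := pselect (A S e); tauto.
Qed.
Lemma def_iff A B : definable A -> definable B ->
  definable (fun S e => A S e <-> B S e).
Proof. by move=> dA dB; apply: def_and; apply: def_imp. Qed.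
Lemma def_all (B : forall S : sets, (nat -> S) -> S -> Prop) :
  definable (fun S e => B S (fun n => e n.+1) (e 0%N)) ->
  definable (fun S e => forall x : S, B S e x).
Proof.
move=> [b bP]; exists (fall b) => S e /=.
by split=> h x; have [k1 k2] := bP S (push_env x e); [exact: (k1 (h x)) | exact: (k2 (h x))].
Qed.
Lemma def_ex (B : forall S : sets, (nat -> S) -> S -> Prop) :
  definable (fun S e => B S (fun n => e n.+1) (e 0%N)) ->
  definable (fun S e => exists x : S, B S e x).
Proof.
move=> /def_not dB; have [f fP] :=
  @def_all (fun S e x => ~ B S e x) dB.
exists (fimp f fbot) => S e /=; rewrite fP; split.
  by move=> h; apply: contrapT => k; apply: h => x Bx; apply: k; exists x.
by move=> [x Bx] h; apply: h Bx.
Qed.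

Ltac solve_definable :=
  cbv beta delta [is_empty is_succ is_upair is_opair is_prod maps is_fun
    is_inductive is_nat binop is_zero is_zmod is_sum coef formal_sum];
  repeat first
    [ exact: def_mem | exact: def_eq
    | apply: def_all | apply: def_ex
    | apply: def_and | apply: def_or | apply: def_iff | apply: def_not
    | apply: def_imp ].


Definition elementary (S V : sets) (star : S -> V) : Prop :=
  forall phi (e : nat -> S), sat e phi <-> sat (star \o e) phi.

(** [|S|^+]-saturation of [V]: every set of at most [|S|] formulas in one variable
    (the index 0), with parameters in [V], is realized as soon as it is finitely
    realized. *)
Definition saturated_over (S V : sets) : Prop :=
  forall (phi : S -> formula) (e : S -> nat -> V),
    (forall J : set S, finite_set J ->
       exists x : V, forall j, J j -> sat (push_env x (e j)) (phi j)) ->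
    exists x : V, forall j, sat (push_env x (e j)) (phi j).

(** What is needed of a universe to handle pairs; it holds in both the standard and
    the internal universe. *)
Record pairing_sets (S : sets) : Prop := PairingSets {
  ps_ext : forall A B : S, (forall x, x ∈ A <-> x ∈ B) -> A = B;
  ps_opair : forall x y : S, exists p, is_opair x y p;
  ps_prod : forall A B : S, exists C, is_prod A B C }.

Record elem (S : sets) (A : S) := Elem { elem_val :> S; elemP : elem_val ∈ A }.
HB.instance Definition _ (S : sets) (A : S) := gen_eqMixin (elem A).
HB.instance Definition _ (S : sets) (A : S) := gen_choiceMixin (elem A).

Lemma elem_inj (S : sets) (A : S) : injective (@elem_val S A).
Proof.
by move=> [x Ax] [y Ay] /= xy; subst y; congr Elem; exact: Prop_irrelevance.
Qed.

Section Pairing.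
Context (S : sets) (hS : pairing_sets S).
Implicit Types (x y z p A B C f : S).

Lemma upair_inj x y x' y' p : is_upair x y p -> is_upair x' y' p ->
  (x = x' /\ y = y') \/ (x = y' /\ y = x').
Proof.
move=> h h'.
have := (h' x).1 ((h x).2 (or_introl erefl)).
have := (h' y).1 ((h y).2 (or_intror erefl)).
have := (h x').1 ((h' x').2 (or_introl erefl)).
have := (h y').1 ((h' y').2 (or_intror erefl)).
by intuition congruence.
Qed.

Lemma opair_inj x y x' y' p : is_opair x y p -> is_opair x' y' p ->
  x = x' /\ y = y'.
Proof.
move=> [u [v [hu [hv hp]]]] [u' [v' [hu' [hv' hp']]]].
have [[? ?]|[? ?]] := upair_inj hp hp'; subst.
- have [[? ?]|[? ?]] := upair_inj hu hu'; subst;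
  by have [[? ?]|[? ?]] := upair_inj hv hv'; subst.
- have := upair_inj hu hv'; have := upair_inj hv hu'.
  by intuition congruence.
Qed.

Lemma upair_fun x y p q : is_upair x y p -> is_upair x y q -> p = q.
Proof.
by move=> hp hq; apply: (ps_ext hS) => u; rewrite (hp u) (hq u).
Qed.

Lemma opair_fun x y p q : is_opair x y p -> is_opair x y q -> p = q.
Proof.
move=> [u [v [hu [hv hp]]]] [u' [v' [hu' [hv' hq]]]].
rewrite (upair_fun hu' hu) (upair_fun hv' hv) in hq.
exact: upair_fun hp hq.
Qed.

Definition opair x y : S := projT1 (cid (ps_opair hS x y)).
Lemma opairP x y : is_opair x y (opair x y).
Proof. exact: (projT2 (cid (ps_opair hS x y))). Qed.
Lemma opairE x y p : is_opair x y p -> p = opair x y.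
Proof. by move=> h; apply: opair_fun h (opairP x y). Qed.

Lemma mapsE f x y : maps f x y <-> opair x y ∈ f.
Proof.
split; first by move=> [p [/opairE ->]].
by move=> h; exists (opair x y); split=> //; exact: opairP.
Qed.

Definition prods A B : S := projT1 (cid (ps_prod hS A B)).
Lemma prodsP A B : is_prod A B (prods A B).
Proof. exact: (projT2 (cid (ps_prod hS A B))). Qed.

Lemma maps_dom f A B x y : is_fun f A B -> maps f x y -> x ∈ A /\ y ∈ B.
Proof.
move=> [h _] [p [hp /h[x' [y' [Ax [By hp']]]]]].
by have [ex ey] := opair_inj hp hp'; rewrite ex ey.
Qed.

Lemma is_fun_inj f g A B : is_fun f A B -> is_fun g A B ->
  (forall x y, maps f x y -> maps g x y) -> f = g.
Proof.
move=> hf hg fg; apply: (ps_ext hS) => p; split => [|] hp.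
  have [x [y [_ [_ o]]]] := hf.1 p hp.
  rewrite (opairE o); apply/mapsE; apply: fg; apply/mapsE.
  by rewrite -(opairE o).
have [x [y [Ax [_ o]]]] := hg.1 p hp.
rewrite (opairE o); apply/mapsE.
have [z xz] := hf.2.1 x Ax.
suff -> : y = z by [].
by apply: (hg.2.2 x); [apply/mapsE; rewrite -(opairE o)|exact: fg].
Qed.

End Pairing.

Record zmod_in (S : sets) := ZmodIn {
  zcarrier : S; zadd : S; zmod_inP : is_zmod zcarrier zadd }.

(** The elements of a group of [S], as a [zmodType]. *)
Definition zelt (S : sets) (hS : pairing_sets S) (G : zmod_in S) : Type :=
  elem (zcarrier G).

Section ZmodOfSet.
Context (S : sets) (hS : pairing_sets S) (G : zmod_in S).
Local Notation T := (zelt hS G).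
Local Notation binop := (binop (zadd G)).
HB.instance Definition _ := Choice.on T.

Let op_ex (x y : T) : exists z : T, binop x y z.
Proof.
have [[P [hP hf]] _] := zmod_inP G.
have [|z [p [e pz]]] := hf.2.1 (opair hS x y).
  by apply/hP; exists x, y; split; [exact: elemP|split; [exact: elemP|exact: opairP]].
have pz' : maps (zadd G) (opair hS x y) z by exists p.
exists (Elem (maps_dom hf pz').2), (opair hS x y); split => //; exact: opairP.
Qed.

Definition zelt_add (x y : T) : T := projT1 (cid (op_ex x y)).
Lemma zelt_addP (x y : T) : binop x y (zelt_add x y).
Proof. exact: (projT2 (cid (op_ex x y))). Qed.

Lemma op_fun x y z w : binop x y z -> binop x y w -> z = w.
Proof.
have [[P [hP hf]] _] := zmod_inP G.
move=> [p [hp pz]] [q [hq qw]]; rewrite (opair_fun hS hq hp) in qw.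
exact: hf.2.2 pz qw.
Qed.

Lemma zelt_addE (x y z : T) : binop x y z <-> z = zelt_add x y :> T.
Proof.
split=> [h| ->]; last exact: zelt_addP.
by apply: elem_inj; exact: op_fun h (zelt_addP x y).
Qed.

Let zero_ex : exists z : T, (forall x : T, binop z x x) /\
  (forall x : T, exists y : T, binop x y z).
Proof.
have [_ [_ [_ [z [[Gz hz] hy]]]]] := zmod_inP G.
exists (Elem Gz); split=> [x|x]; first by apply: hz; exact: elemP.
by have [y [Gy xy]] := hy x (elemP x); exists (Elem Gy).
Qed.

Definition zelt_zero : T := projT1 (cid zero_ex).
Let zeroP := projT2 (cid zero_ex).
Definition zelt_opp (x : T) : T := projT1 (cid (zeroP.2 x)).
Let oppP (x : T) : binop x (zelt_opp x) zelt_zero :=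
  projT2 (cid (zeroP.2 x)).

Let addA : associative zelt_add.
Proof.
move=> x y z; have [_ [h _]] := zmod_inP G; apply: elem_inj.
apply: (@op_fun x (zelt_add y z)); first exact: zelt_addP.
by apply: (h x y z (zelt_add x y) _ (zelt_add y z)); exact: zelt_addP.
Qed.
Let addC : commutative zelt_add.
Proof.
move=> x y; have [_ [_ [h _]]] := zmod_inP G; apply/esym/zelt_addE.
by apply: h; exact: zelt_addP.
Qed.
Let add0 : left_id zelt_zero zelt_add.
Proof. by move=> x; apply/esym/zelt_addE; exact: zeroP.1. Qed.
Let addN : left_inverse zelt_zero zelt_opp zelt_add.
Proof. by move=> x; rewrite addC; apply/esym/zelt_addE; exact: oppP. Qed.
HB.instance Definition _ := GRing.isZmodule.Build T addA addC add0 addN.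

Lemma opE (x y : T) (z : S) : binop x y z <-> z = (x + y : T).
Proof.
split=> [h| ->]; last exact: zelt_addP.
exact: op_fun h (zelt_addP x y).
Qed.

Lemma is_zeroE (z : S) : is_zero (zcarrier G) (zadd G) z <-> z = (0 : T).
Proof.
split=> [[Gz hz]| ->]; last first.
  by split=> [|x Gx]; [exact: elemP|apply/(opE 0 (Elem Gx)); rewrite add0r].
have /(opE (Elem Gz) 0) := hz (0 : T) (elemP _).
by rewrite addr0 => ->.
Qed.
End ZmodOfSet.

Section StandardUniverse.
Context (S : sets) (hU : standard_universe S).
Implicit Types (x y z p A B C f g n m s : S).

Lemma pairing_standard : pairing_sets S.
Proof.
split; first exact: su_ext hU.
  move=> x y; have [u hu] := su_pair hU x x; have [v hv] := su_pair hU x y.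
  by have [p hp] := su_pair hU u v; exists p, u, v.
move=> A B; have [AB hAB] := su_pair hU A B.
have [D hD] := su_union hU AB.
have [D1 hD1] := su_power hU D; have [D2 hD2] := su_power hU D1.
have [C hC] := su_separation hU D2
  (fun z => exists x y, x ∈ A /\ y ∈ B /\ is_opair x y z).
exists C => z; split=> [/hC[//]|h]; apply/hC; split=> //.
have [x [y [Ax [By [u [v [hu [hv hz]]]]]]]] := h.
have Dx : x ∈ D by apply/hD; exists A; split=> //; apply/hAB; left.
have Dy : y ∈ D by apply/hD; exists B; split=> //; apply/hAB; right.
by apply/hD2 => w /hz [] ->; apply/hD1 => t; [move=> /hu|move=> /hv] => -[] ->.
Qed.
Let hS := pairing_standard.

Lemma fun_graph A B (R : S -> S -> Prop) :
  (forall x, x ∈ A -> exists y, y ∈ B /\ R x y) ->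
  (forall x y z, R x y -> R x z -> y = z) ->
  exists f, is_fun f A B /\ forall x y, maps f x y <-> [/\ x ∈ A, y ∈ B & R x y].
Proof.
move=> tot fct.
have [f hf] := su_separation hU (prods hS A B)
  (fun p => exists x y, R x y /\ is_opair x y p).
have mf x y : maps f x y <-> [/\ x ∈ A, y ∈ B & R x y].
  split=> [[p [hp /hf[/prodsP[x1 [y1 [Ax [By hp1]]]] [x2 [y2 [xy hp2]]]]]]|].
    have [? ?] := opair_inj hp hp1; have [? ?] := opair_inj hp hp2; subst.
    by split; subst.
  move=> [Ax By xy]; exists (opair hS x y); split; first exact: opairP.
  apply/hf; split; last by exists x, y; split=> //; exact: opairP.
  by apply/prodsP; exists x, y; split=> //; split=> //; exact: opairP.
exists f; split=> //; split; [|split].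
- by move=> p /hf[/prodsP].
- by move=> x Ax; have [y [By xy]] := tot x Ax; exists y; apply/mf; split.
- by move=> x y z /mf[_ _ xy] /mf[_ _ xz]; exact: fct xy xz.
Qed.

Lemma empty_exists : exists z : S, is_empty z.
Proof.
have [A _] := su_infinity hU; have [z hz] := su_separation hU A (fun=> False).
by exists z => x /hz[].
Qed.

Lemma succ_exists n : exists m, is_succ n m.
Proof.
have [u hu] := su_pair hU n n; have [v hv] := su_pair hU n u.
have [m hm] := su_union hU v; exists m => x; split.
  move=> /hm[y [/hv[] -> xy]]; first by left.
  by right; have [] := (hu x).1 xy.
move=> [xn| ->]; apply/hm; first by exists n; split=> //; apply/hv; left.
by exists u; split; [apply/hv; right|apply/hu; left].
Qed.

Definition nsucc n : S := projT1 (cid (succ_exists n)).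
Lemma nsuccP n : is_succ n (nsucc n).
Proof. exact: (projT2 (cid (succ_exists n))). Qed.
Lemma succE n m : is_succ n m -> m = nsucc n.
Proof. by move=> h; apply: (su_ext hU) => x; rewrite (h x) (nsuccP n x). Qed.

Fixpoint num (k : nat) : S :=
  if k is k'.+1 then nsucc (num k') else projT1 (cid empty_exists).

Lemma num0 : is_empty (num 0).
Proof. exact: (projT2 (cid empty_exists)). Qed.
Lemma emptyE z : is_empty z -> z = num 0.
Proof. by move=> h; apply: (su_ext hU) => x; split=> [/h|/num0]. Qed.

Lemma mem_num k x : x ∈ num k <-> exists2 j, (j < k)%N & x = num j.
Proof.
elim: k x => [|k IH] x; first by split=> [/num0//|[]].
split=> [/nsuccP[/IH[j jk ->]|->]|[j]]; first by exists j => //; exact: ltnW.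
  by exists k.
rewrite ltnS leq_eqVlt => /orP[/eqP->|jk] ->; apply/nsuccP; [by right|left].
by apply/IH; exists j.
Qed.

Lemma num_lt_neq k j : (j < k)%N -> num j <> num k.
Proof.
elim: k j => [//|k IH] j jk jk1.
have : num k ∈ num j by rewrite jk1; apply/nsuccP; right.
move=> /mem_num[i ij ki]; apply: (IH i) => //; exact: leq_trans ij _.
Qed.

Lemma num_inj : injective num.
Proof.
move=> i j ij; have [h|h|//] := ltngtP i j; first by case: (num_lt_neq h).
by case: (num_lt_neq h).
Qed.

Lemma is_natP n : is_nat n <-> exists k, n = num k.
Proof.
split=> [nn|[k ->] A [A0 A1]]; last first.
  by elim: k => [|k IH]; [exact/A0/num0|apply: A1 IH _; exact: nsuccP].
have [A [A0 A1]] := su_infinity hU.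
have [B hB] := su_separation hU A (fun x => exists k, x = num k).
have /hB[//] : n ∈ B; apply: nn; split=> [z hz|m m' /hB[Am [k mk]] mm'].
  by apply/hB; split; [exact: A0|exists 0%N; exact: emptyE].
by apply/hB; split; [exact: A1 mm'|exists k.+1; rewrite (succE mm') mk].
Qed.

Section Sums.
Context (G : zmod_in S).
Local Notation T := (zelt hS G).
Local Notation Gs := (zcarrier G).
Local Notation Ga := (zadd G).

Lemma is_sumP k (u : S -> S -> Prop) (v : nat -> T) r :
  (forall i, (i < k)%N -> forall y, u (num i) y <-> y = v i) ->
  is_sum Gs Ga (num k) u r <-> r = \sum_(i < k) v i.
Proof.
move=> uv; split=> [[m [P [/succE-> [hP [P0 [PS Pr]]]]]]| ->].
  suff H j : (j <= k)%N -> maps P (num j) (\sum_(i < j) v i : T).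
    exact: hP.2.2 Pr (H k (leqnn k)).
  elim: j => [_|j IH jk]; first by apply: P0; [exact: num0|rewrite big_ord0; exact/is_zeroE].
  apply: (PS (num j) _ _ (v j)) (IH (ltnW jk)) _ _.
  - by apply/mem_num; exists j.
  - exact: nsuccP.
  - exact/uv.
  - by apply/opE; rewrite big_ord_recr.
have [||P [hP mP]] := @fun_graph (nsucc (num k)) Gs
  (fun x y => exists2 j, x = num j & y = (\sum_(i < j) v i : T)).
- move=> x /(mem_num k.+1)[j jk ->]; exists (\sum_(i < j) v i : T).
  by split; [exact: elemP|exists j].
- by move=> x y z [j -> ->] [i /num_inj -> ->].
exists (nsucc (num k)), P; split; first exact: nsuccP.
split=> //; split; [|split].
- move=> i z /emptyE-> /is_zeroE->; apply/mP; split.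
  + by apply/(mem_num k.+1); exists 0%N.
  + exact: elemP.
  + by exists 0%N => //; rewrite big_ord0.
- move=> i j x y z /mem_num[i' i'k ->] /succE-> /mP[_ _ [i2 /num_inj<- ->]].
  move=> /(uv _ i'k) -> /opE ->; apply/mP; split.
  + by apply/(mem_num k.+1); exists i'.+1.
  + exact: elemP.
  + by exists i'.+1 => //; rewrite big_ord_recr.
- apply/mP; split; [|exact: elemP|by exists k].
  by apply/nsuccP; right.
Qed.

Lemma seqP A f k : is_fun f (num k) A ->
  exists v : nat -> S, forall i, (i < k)%N -> maps f (num i) (v i).
Proof.
move=> hf; suff H i : exists y, (i < k)%N -> maps f (num i) y.
  by have [v hv] := choice H; exists v.
case: (ltnP i k) => ik; last by exists (num 0).
by have [|y hy] := hf.2.1 (num i); [apply/mem_num; exists i|exists y].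
Qed.

Lemma zseqP f k : is_fun f (num k) Gs ->
  exists v : nat -> T, forall i, (i < k)%N -> maps f (num i) (v i).
Proof.
move=> hf; suff H i : exists y : T, (i < k)%N -> maps f (num i) y.
  by have [v hv] := choice H; exists v.
case: (ltnP i k) => ik; last by exists 0.
have [|y hy] := hf.2.1 (num i); first by apply/mem_num; exists i.
by exists (Elem (maps_dom hf hy).2).
Qed.

Lemma seq_mk A (v : nat -> S) k : (forall i, (i < k)%N -> v i ∈ A) ->
  exists f, is_fun f (num k) A /\
    forall i, (i < k)%N -> maps f (num i) (v i).
Proof.
move=> vA; have [||f [hf mf]] := @fun_graph (num k) A
  (fun x y => exists2 i, x = num i & y = v i).
- by move=> x /mem_num[i ik ->]; exists (v i); split; [exact: vA|exists i].
- by move=> x y z [i -> ->] [j /num_inj -> ->].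
exists f; split=> // i ik; apply/mf; split; [|exact: vA|by exists i].
by apply/mem_num; exists i.
Qed.

Lemma maps_num A f k (v : nat -> S) i y : is_fun f (num k) A ->
  (forall i, (i < k)%N -> maps f (num i) (v i)) ->
  (i < k)%N -> maps f (num i) y <-> y = v i.
Proof.
move=> hf hv ik; split=> [h| ->]; last exact: hv.
exact: hf.2.2 h (hv i ik).
Qed.

Definition tcoef (s : nat -> S) (g : nat -> T) (t : S) (i : nat) : T :=
  if `[< s i = t >] then g i else 0.

Lemma formal_sumP A k g s c (g' : nat -> T) (s' : nat -> S) :
  is_fun g (num k) Gs -> is_fun s (num k) A ->
  (forall i, (i < k)%N -> maps g (num i) (g' i)) ->
  (forall i, (i < k)%N -> maps s (num i) (s' i)) ->
  formal_sum Gs Ga A (num k) g s c <->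
  is_fun c A Gs /\ forall t y, maps c t y -> y = \sum_(i < k) tcoef s' g' t i.
Proof.
move=> hg hs gE sE.
have H t i : (i < k)%N ->
    forall y, coef Gs Ga g s t (num i) y <-> y = tcoef s' g' t i.
  move=> ik y; rewrite /coef /tcoef; split.
    move=> [x [/(maps_num x hs sE ik)-> [[xt gy]|[xt]]]].
      by rewrite asboolT //; apply/(maps_num _ hg gE ik).
    by rewrite asboolF // => /is_zeroE.
  move=> ->; exists (s' i); split; first exact: sE.
  case: asboolP => st; [left|right]; split=> //; first exact: gE.
  exact/is_zeroE.
split=> [[_ [_ [_ [hc h]]]]|[hc h]].
  by split=> // t y /h /(is_sumP _ (H t)).
split; first by apply/is_natP; exists k.
by do 3!split=> //; move=> t y /h yE; apply/(is_sumP _ (H t)).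
Qed.

Lemma chain_mk A (c : S -> T) :
  exists f, is_fun f A Gs /\ forall t, t ∈ A -> maps f t (c t).
Proof.
have [||f [hf mf]] := @fun_graph A Gs (fun x y => y = c x).
- by move=> x Ax; exists (c x); split=> //; exact: elemP.
- by move=> x y z -> ->.
by exists f; split=> // t At; apply/mf; split=> //; exact: elemP.
Qed.

End Sums.
End StandardUniverse.

(** Statements about functions and formal sums that are proved in the standard
    universe and transferred to the internal one. *)
Definition pushes_seq (S : sets) (s f h : S) : Prop :=
  forall i x y, maps s i x -> maps f x y -> maps h i y.

Definition fact_comp (S : sets) : Prop := forall A B C f g : S,
  is_fun f A B -> is_fun g B C -> exists h, is_fun h A C /\ pushes_seq f g h.
Definition fact_pair (S : sets) : Prop := forall D A B P f g : S,
  is_prod A B P -> is_fun f D A -> is_fun g D B -> exists h, is_fun h D P /\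
  forall x y z p, maps f x y -> maps g x z -> is_opair y z p -> maps h x p.
Definition fact_proj (S : sets) : Prop := forall A B P : S, is_prod A B P ->
  exists f g, is_fun f P A /\ is_fun g P B /\ forall x y p,
    p ∈ P -> is_opair x y p -> maps f p x /\ maps g p y.
Definition fact_id (S : sets) : Prop := forall A : S,
  exists f, is_fun f A A /\ forall x, x ∈ A -> maps f x x.

Definition fact_sum_ex (S : sets) : Prop := forall G a A n g s : S,
  is_zmod G a -> is_nat n -> is_fun g n G -> is_fun s n A ->
  exists c, formal_sum G a A n g s c.
Definition fact_sum_uniq (S : sets) : Prop := forall G a A n g s c d : S,
  is_zmod G a -> formal_sum G a A n g s c -> formal_sum G a A n g s d -> c = d.
Definition fact_sum_zero (S : sets) : Prop := forall G a A : S, is_zmod G a ->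
  exists n g s c, formal_sum G a A n g s c /\ (forall i x, ~ maps s i x) /\
    forall t y, maps c t y -> is_zero G a y.
Definition fact_sum_sub (S : sets) : Prop := forall G a A n g s c n1 g1 s1 c1 : S,
  is_zmod G a ->
  formal_sum G a A n g s c -> formal_sum G a A n1 g1 s1 c1 ->
  exists n2 g2 s2 c2, formal_sum G a A n2 g2 s2 c2 /\
    (forall i x, maps s2 i x -> exists j, maps s j x \/ maps s1 j x) /\
    (forall t x x1 x2, maps c t x -> maps c1 t x1 -> maps c2 t x2 ->
       binop a x1 x2 x) /\
    forall B f h h1 h2 d d1 d2, is_fun f A B ->
      pushes_seq s f h -> pushes_seq s1 f h1 -> pushes_seq s2 f h2 ->
      formal_sum G a B n g h d -> formal_sum G a B n1 g1 h1 d1 ->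
      formal_sum G a B n2 g2 h2 d2 ->
      forall t x x1 x2, maps d t x -> maps d1 t x1 -> maps d2 t x2 ->
       binop a x1 x2 x.
Definition fact_sum_push0 (S : sets) : Prop := forall G a A B n g s c f h d : S,
  is_zmod G a -> formal_sum G a A n g s c ->
  (forall t y, maps c t y -> is_zero G a y) -> is_fun f A B ->
  pushes_seq s f h -> formal_sum G a B n g h d ->
  forall t y, maps d t y -> is_zero G a y.

Section StandardFacts.
Context (S : sets) (hU : standard_universe S).
Let hS := pairing_standard hU.
Local Notation num := (num hU).

Lemma std_comp : fact_comp S.
Proof.
move=> A B C f g hf hg.
have [||h [hh mh]] := @fun_graph S hU A C
  (fun x z => exists y, maps f x y /\ maps g y z).
- move=> x Ax; have [y xy] := hf.2.1 x Ax; have [_ By] := maps_dom hf xy.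
  have [z yz] := hg.2.1 y By; have [_ Cz] := maps_dom hg yz.
  by exists z; split=> //; exists y.
- move=> x z z' [y [xy yz]] [y' [xy' yz']].
  by rewrite (hf.2.2 _ _ _ xy' xy) in yz'; exact: hg.2.2 yz yz'.
exists h; split=> // x y z xy yz; apply/mh; split; last by exists y.
  exact: (maps_dom hf xy).1.
exact: (maps_dom hg yz).2.
Qed.

Lemma std_pair : fact_pair S.
Proof.
move=> D A B P f g hP hf hg.
have [||h [hh mh]] := @fun_graph S hU D P
  (fun x p => exists y z, [/\ maps f x y, maps g x z & is_opair y z p]).
- move=> x Dx; have [y xy] := hf.2.1 x Dx; have [_ Ay] := maps_dom hf xy.
  have [z xz] := hg.2.1 x Dx; have [_ Bz] := maps_dom hg xz.
  have yz := opairP hS y z.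
  by exists (opair hS y z); split; [apply/hP; exists y, z|exists y, z].
- move=> x p q [y [z [xy xz hp]]] [y' [z' [xy' xz' hq]]].
  rewrite (hf.2.2 _ _ _ xy' xy) (hg.2.2 _ _ _ xz' xz) in hq.
  exact: opair_fun hp hq.
exists h; split=> // x y z p xy xz hp; apply/mh; split; last by exists y, z.
  exact: (maps_dom hf xy).1.
apply/hP; exists y, z; split; first exact: (maps_dom hf xy).2.
by split=> //; exact: (maps_dom hg xz).2.
Qed.

Lemma std_proj : fact_proj S.
Proof.
move=> A B P hP.
have [||f [hf mf]] := @fun_graph S hU P A (fun p x => exists y, is_opair x y p).
- by move=> p /hP[x [y [Ax [By hp]]]]; exists x; split=> //; exists y.
- by move=> p x x' [y h] [y' h']; have [] := opair_inj h h'.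
have [||g [hg mg]] := @fun_graph S hU P B (fun p y => exists x, is_opair x y p).
- by move=> p /hP[x [y [Ax [By hp]]]]; exists y; split=> //; exists x.
- by move=> p y y' [x h] [x' h']; have [] := opair_inj h h'.
exists f, g; split=> //; split=> // x y p Pp hp.
have /hP[x' [y' [Ax [By hp']]]] := Pp; have [? ?] := opair_inj hp hp'; subst.
by split; [apply/mf; split=> //; exists y'|apply/mg; split=> //; exists x'].
Qed.

Lemma std_id : fact_id S.
Proof.
move=> A; have [||f [hf mf]] := @fun_graph S hU A A (fun x y => x = y).
- by move=> x Ax; exists x.
- by move=> x y z -> .
by exists f; split=> // x Ax; apply/mf; split.
Qed.

Section Sums.
Context (G a : S) (hG : is_zmod G a).
Let G' := ZmodIn hG.
Local Notation T := (zelt hS G').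

Lemma std_sumP A n g s c : formal_sum G a A n g s c -> exists k g' s',
  [/\ n = num k,
   forall i, (i < k)%N -> maps g (num i) (g' i : T),
   forall i, (i < k)%N -> maps s (num i) (s' i),
   (forall i, (i < k)%N -> s' i ∈ A) &
   forall t y, maps c t y -> y = \sum_(i < k) tcoef s' g' t i].
Proof.
move=> h; have [/(is_natP hU)[k nk] [hg [hs _]]] := h; subst n.
have [g' hg'] := zseqP (G := G') hg; have [s' hs'] := seqP hs.
exists k, g', s'; split=> //.
  by move=> i ik; exact: (maps_dom hs (hs' i ik)).2.
have [hc _] := @formal_sumP S hU G' A k g s c g' s' hg hs hg' hs'.
by have [_ ?] := hc h.
Qed.

Lemma std_sum_mk A k (g' : nat -> T) (s' : nat -> S) :
  (forall i, (i < k)%N -> s' i ∈ A) ->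
  exists g s c, [/\ formal_sum G a A (num k) g s c,
    is_fun s (num k) A,
    forall i, (i < k)%N -> maps g (num i) (g' i : T) &
    forall i, (i < k)%N -> maps s (num i) (s' i)].
Proof.
move=> sA; have [g [hg gE]] : exists g, is_fun g (num k) G /\
    forall i, (i < k)%N -> maps g (num i) (g' i : T).
  by apply: (@seq_mk S hU G g') => i _; exact: elemP.
have [s [hs sE]] := @seq_mk S hU A s' k sA.
have [c [hc cE]] := @chain_mk S hU G' A
  (fun t => \sum_(i < k) tcoef s' g' t i).
exists g, s, c; split=> //.
apply/(@formal_sumP S hU G' A k g s c g' s') => //; split=> // t y ty.
by apply: hc.2.2 ty (cE t (maps_dom hc ty).1).
Qed.

End Sums.

Lemma std_sum_ex : fact_sum_ex S.
Proof.
move=> G a A n g s hG /(is_natP hU)[k ->] hg hs.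
pose G' := ZmodIn hG.
have [g' hg'] := zseqP (G := G') hg; have [s' hs'] := seqP hs.
have [c [hc cE]] := @chain_mk S hU G' A
  (fun t => \sum_(i < k) tcoef s' g' t i).
exists c; apply/(@formal_sumP S hU G' A k g s c g' s') => //; split=> // t y ty.
by apply: hc.2.2 ty (cE t (maps_dom hc ty).1).
Qed.

Lemma std_sum_uniq : fact_sum_uniq S.
Proof.
move=> G a A n g s c d hG hc hd.
have [/(is_natP hU)[k nk] [hg [hs [hfc _]]]] := hc; subst n.
have [_ [_ [_ [hfd _]]]] := hd.
pose G' := ZmodIn hG.
have [g' hg'] := zseqP (G := G') hg; have [s' hs'] := seqP hs.
have [/(_ hc)[_ cE] _] := @formal_sumP S hU G' A k g s c g' s' hg hs hg' hs'.
have [/(_ hd)[_ dE] _] := @formal_sumP S hU G' A k g s d g' s' hg hs hg' hs'.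
apply: (is_fun_inj hS hfc hfd) => x y xy.
have [z xz] := hfd.2.1 x (maps_dom hfc xy).1.
by rewrite (cE _ _ xy) -(dE _ _ xz).
Qed.

Lemma num_dom k f A i x : is_fun f (num k) A -> maps f i x ->
  exists2 j, (j < k)%N & i = num j.
Proof. by move=> hf /(maps_dom hf)[/mem_num]. Qed.

Lemma std_sum_zero : fact_sum_zero S.
Proof.
move=> G a A hG; pose G' := ZmodIn hG.
have [g [s [c [h hs _ _]]]] := @std_sum_mk G a hG A 0 (fun=> 0) (fun=> num 0)
  (fun i (h : (i < 0)%N) => False_ind _ (elimF idP (ltn0 i) h)).
exists (num 0), g, s, c; split=> //; split=> [i x ix|t y ty].
  by have [j] := num_dom hs ix.
have [k [g' [s' [k0 _ _ _ cE]]]] := std_sumP hG h.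
have {}k0 : k = 0%N by apply: (@num_inj S hU); rewrite k0.
by apply/(@is_zeroE S hS G'); rewrite (cE _ _ ty) k0 big_ord0.
Qed.

Definition catf (X : Type) (k : nat) (u v : nat -> X) i :=
  if (i < k)%N then u i else v (i - k)%N.

Lemma std_sum_sub : fact_sum_sub S.
Proof.
move=> G a A n g s c n1 g1 s1 c1 hG h h1; pose G' := ZmodIn hG.
have [k [g' [s' [nk gE sE sA cE]]]] := std_sumP hG h; subst n.
have [k1 [g1' [s1' [nk gE1 sE1 sA1 cE1]]]] := std_sumP hG h1; subst n1.
pose g2' : nat -> zelt hS G' := catf k g' (fun i => - g1' i).
pose s2' := catf k s' s1'.
have catE (i : nat) : (i < k + k1)%N -> ~~ (i < k)%N -> (i - k < k1)%N.
  by rewrite -leqNgt => ? ?; rewrite ltn_subLR.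
have sA2 i : (i < k + k1)%N -> s2' i ∈ A.
  move=> ik; rewrite /s2' /catf; case: ifPn => [/sA//|ik']; apply: sA1.
  exact: catE.
have sumE (u u1 u2 : nat -> S) t :
    (forall i, (i < k)%N -> u2 i = u i) ->
    (forall i, (i < k1)%N -> u2 (k + i)%N = u1 i) ->
    \sum_(i < k + k1) tcoef u2 g2' t i =
    \sum_(i < k) tcoef u g' t i - \sum_(i < k1) tcoef u1 g1' t i.
  move=> hu hu1; rewrite big_split_ord /= -sumrN; congr (_ + _).
    by apply: eq_bigr => i _; rewrite /tcoef hu // /g2' /catf /= ltn_ord.
  apply: eq_bigr => i _; rewrite /tcoef hu1 // /g2' /catf /=.
  rewrite ltnNge leq_addr /= addKn.
  by case: asboolP => // _; rewrite oppr0.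
have opD (x x1 : zelt hS G') : binop a x1 (x - x1 : zelt hS G') x.
  by apply/(@opE S hS G'); rewrite subrKC.
have [g2 [s2 [c2 [h2 hs2 gE2 sE2]]]] :=
  @std_sum_mk G a hG A (k + k1) g2' s2' sA2.
have mE u v1 v2 x y (B : S) : is_fun u (num v1) B -> maps u (num v2) x ->
  maps u (num v2) y -> x = y by move=> hu; exact: hu.2.2.
exists (num (k + k1)), g2, s2, c2; split=> //; split; last split.
- move=> i x ix; have [j jk ij] := num_dom hs2 ix; subst i.
  have -> := hs2.2.2 _ _ _ ix (sE2 j jk).
  rewrite /s2' /catf; case: ifPn => jk'; first by exists (num j); left; exact: sE.
  by exists (num (j - k)); right; apply: sE1; exact: catE.
- move=> t x x1 x2 /cE -> /cE1 ->.
  have [_ [hg2 [_ _]]] := h2.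
  have [/(_ h2)[_ c2E] _] := @formal_sumP S hU G' A (k + k1) g2 s2 c2 g2' s2'
    hg2 hs2 gE2 sE2.
  move=> /c2E ->; rewrite (sumE s' s1') //.
  + by move=> i ik; rewrite /s2' /catf ik.
  + by move=> i ik; rewrite /s2' /catf ltnNge leq_addr /= addKn.
move=> B f e e1 e2 d d1 d2 hf he he1 he2 hd hd1 hd2 t x x1 x2.
have [_ [hg [fe [fd _]]]] := hd; have [_ [hg1 [fe1 [fd1 _]]]] := hd1.
have [_ [hg2 [fe2 [fd2 _]]]] := hd2.
have [e' eE] := seqP fe; have [e1' eE1] := seqP fe1; have [e2' eE2] := seqP fe2.
have [/(_ hd)[_ dE] _] := @formal_sumP S hU G' B k g e d g' e' hg fe gE eE.
have [/(_ hd1)[_ dE1] _] :=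
  @formal_sumP S hU G' B k1 g1 e1 d1 g1' e1' hg1 fe1 gE1 eE1.
have [/(_ hd2)[_ dE2] _] :=
  @formal_sumP S hU G' B (k + k1) g2 e2 d2 g2' e2' hg2 fe2 gE2 eE2.
move=> /dE -> /dE1 -> /dE2 ->; rewrite (sumE e' e1') //.
  move=> i ik; have ik2 : (i < k + k1)%N by apply: leq_trans ik (leq_addr _ _).
  have [y xy] := hf.2.1 _ (sA i ik).
  rewrite (fe.2.2 _ _ _ (eE i ik) (he _ _ _ (sE i ik) xy)).
  have := sE2 i ik2; rewrite {1}/s2' /catf ik => m2.
  exact: fe2.2.2 (eE2 i ik2) (he2 _ _ _ m2 xy).
move=> i ik; have ik2 : (k + i < k + k1)%N by rewrite ltn_add2l.
have [y xy] := hf.2.1 _ (sA1 i ik).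
rewrite (fe1.2.2 _ _ _ (eE1 i ik) (he1 _ _ _ (sE1 i ik) xy)).
have := sE2 _ ik2; rewrite {1}/s2' /catf ltnNge leq_addr /= addKn => m2.
exact: fe2.2.2 (eE2 _ ik2) (he2 _ _ _ m2 xy).
Qed.

Lemma std_sum_push0 : fact_sum_push0 S.
Proof.
move=> G a A B n g s c f e d hG hc c0 hf he hd t y ty; pose G' := ZmodIn hG.
have [k [g' [s' [nk gE sE sA cE]]]] := std_sumP hG hc; subst n.
have [_ [hg [fe [fd _]]]] := hd; have [e' eE] := seqP fe.
have [/(_ hd)[_ dE] _] := @formal_sumP S hU G' B k g e d g' e' hg fe gE eE.
apply/(@is_zeroE S hS G'); rewrite (dE _ _ ty); congr elem_val.
have [_ [_ [_ [fc _]]]] := hc.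
have c0E x : x ∈ A -> \sum_(i < k) tcoef s' g' x i = 0.
  move=> Ax; have [z xz] := fc.2.1 x Ax.
  apply: elem_inj; rewrite -(cE _ _ xz); apply/(@is_zeroE S hS G').
  exact: c0 xz.
pose w (i : 'I_k) : {classic S} := s' i.
pose r := undup [seq w i | i <- enum 'I_k].
have wr i : w i \in r by rewrite mem_undup map_f // mem_enum.
have split_r (i : 'I_k) : tcoef e' g' t i =
    \sum_(x <- r) if x == w i then tcoef e' g' t i else 0.
  rewrite (bigD1_seq (w i)) ?undup_uniq ?wr //= eqxx.
  by rewrite big1_seq ?addr0 // => x /andP[/negbTE->].
rewrite (eq_bigr _ (fun i _ => split_r i)) exchange_big /=.
rewrite big1_seq // => x /=; rewrite mem_undup => /mapP[i0 _ xi0].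
have Ax : x ∈ A by rewrite xi0; exact: sA.
have [y0 xy0] := hf.2.1 x Ax.
have eE0 (i : 'I_k) : x = w i -> e' i = y0.
  move=> xi; apply: fe.2.2 (eE i (ltn_ord i)) (he _ _ _ (sE i (ltn_ord i)) _).
  by rewrite -/(w i) -xi.
have [y0t|y0t] := pselect (y0 = t); last first.
  apply: big1 => i _; case: eqP => // xi.
  by rewrite /tcoef (eE0 i xi) asboolF.
rewrite -[RHS](c0E x Ax); apply: eq_bigr => i _.
case: eqP => xi; rewrite /tcoef; last by rewrite asboolF // => h; apply: xi.
by rewrite (eE0 i xi) asboolT // asboolT.
Qed.

End StandardFacts.

Record nonstandard_universe := NonstandardUniverse {
  stdU : sets;
  intU : sets;
  star : stdU -> intU;
  stdU_standard : standard_universe stdU;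
  star_elementary : elementary star;
  intU_saturated : saturated_over stdU intU }.
Arguments star {n}.

Ltac definability := unfold fact_comp, fact_pair, fact_proj, fact_id,
  fact_sum_ex, fact_sum_uniq, fact_sum_zero, fact_sum_sub, fact_sum_push0,
  pushes_seq; solve_definable.

Section Transfer.
Context (N : nonstandard_universe).
Local Notation U := (stdU N).
Local Notation V := (intU N).

Lemma transfer_env (P : forall S : sets, (nat -> S) -> Prop) (e : nat -> U) :
  definable P -> P U e <-> P V (star \o e).
Proof. by move=> [phi hphi]; rewrite -!hphi; exact: star_elementary. Qed.

Lemma transfer (Q : sets -> Prop) : definable (fun S _ => Q S) -> Q U -> Q V.
Proof.
have [A _] := su_infinity (stdU_standard N).
by move=> dQ /(@transfer_env _ (fun=> A) dQ).
Qed.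

Lemma pairing_intU : pairing_sets V.
Proof.
have h := pairing_standard (stdU_standard N).
split.
- apply: (@transfer (fun S => forall A B : S,
    (forall x, x ∈ A <-> x ∈ B) -> A = B)); [|exact: ps_ext h].
  by solve_definable.
- apply: (@transfer (fun S => forall x y : S, exists p, is_opair x y p));
    [|exact: ps_opair h].
  by solve_definable.
- apply: (@transfer (fun S => forall A B : S, exists C, is_prod A B C));
    [|exact: ps_prod h].
  by solve_definable.
Qed.

Lemma int_comp : fact_comp V.
Proof. by apply: transfer (std_comp (stdU_standard N)); definability. Qed.
Lemma int_pair : fact_pair V.
Proof. by apply: transfer (std_pair (stdU_standard N)); definability. Qed.
Lemma int_proj : fact_proj V.
Proof. by apply: transfer (std_proj (stdU_standard N)); definability. Qed.
Lemma int_id : fact_id V.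
Proof. by apply: transfer (std_id (stdU_standard N)); definability. Qed.
Lemma int_sum_ex : fact_sum_ex V.
Proof. by apply: transfer (std_sum_ex (stdU_standard N)); definability. Qed.
Lemma int_sum_uniq : fact_sum_uniq V.
Proof. by apply: transfer (std_sum_uniq (stdU_standard N)); definability. Qed.
Lemma int_sum_zero : fact_sum_zero V.
Proof. by apply: transfer (std_sum_zero (stdU_standard N)); definability. Qed.
Lemma int_sum_sub : fact_sum_sub V.
Proof. by apply: transfer (std_sum_sub (stdU_standard N)); definability. Qed.
Lemma int_sum_push0 : fact_sum_push0 V.
Proof. by apply: transfer (std_sum_push0 (stdU_standard N)); definability. Qed.

Lemma star_prod (A B C : U) :
  is_prod A B C -> is_prod (star A) (star B) (star C).
Proof.
move=> h.
have d : definable (fun S e => is_prod (e 0%N) (e 1%N) (e 2%N : S)).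
  by solve_definable.
by have [h1 _] := transfer_env (push_env A (push_env B (fun=> C))) d; exact: h1.
Qed.

Lemma star_mem (x A : U) : x ∈ A <-> star x ∈ star A.
Proof.
have d : definable (fun S e => (e 0%N : S) ∈ e 1%N) by exact: def_mem.
exact: (transfer_env (push_env x (fun=> A)) d).
Qed.

End Transfer.

(** [coded S T]: the Rocq type [T] is an element of the universe [S], namely the set
    [code] in bijection with [T] by [enc]. For [S] the standard universe, this says
    that [T] is a standard set; for [S] the internal universe, that [T] is an
    internal set. *)
Record coded (S : sets) (T : Type) := Coded {
  enc :> T -> S;
  enc_inj : injective enc;
  code : S;
  codeP : forall u, u ∈ code <-> exists x, enc x = u }.

Definition elem_coded (S : sets) (A : S) : coded S (elem A).
Proof.
apply: (@Coded S (elem A) (@elem_val S A) (@elem_inj S A) A) => u.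
by split=> [Au|[x <-]]; [exists (Elem Au)|exact: elemP].
Defined.

Definition graph_of (S : sets) (T T' : Type) (c : coded S T) (c' : coded S T')
    (f : T -> T') (F : S) : Prop :=
  forall z, z ∈ F <-> exists x, is_opair (c x) (c' (f x)) z.

(** A function between internal sets is internal if its graph is. *)
Definition internal (S : sets) (T T' : Type) (c : coded S T) (c' : coded S T')
    (f : T -> T') : Prop :=
  exists F : S, graph_of c c' f F.

Section Coded.
Context (S : sets) (hS : pairing_sets S).

Lemma code_enc (T : Type) (c : coded S T) x : c x ∈ code c.
Proof. by apply/codeP; exists x. Qed.

Section Prod.
Context (T T' : Type) (c : coded S T) (c' : coded S T').

Definition prod_enc (x : T * T') : S := opair hS (c x.1) (c' x.2).

Lemma prod_enc_inj : injective prod_enc.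
Proof.
move=> [x x'] [y y'] /= e.
have := opairP hS (c x) (c' x'); rewrite -/(prod_enc (x, x')) e => h.
have [e1 e2] := opair_inj h (opairP hS (c y) (c' y')).
by rewrite (enc_inj e1) (enc_inj e2).
Qed.

Lemma prod_codeP u :
  u ∈ prods hS (code c) (code c') <-> exists x, prod_enc x = u.
Proof.
split=> [/prodsP[a [b [/codeP[x <-] [/codeP[y <-] /opairE ->]]]]|[[x y] <-]].
  by exists (x, y).
apply/prodsP; exists (c x), (c' y); split; first exact: code_enc.
by split; [exact: code_enc|exact: opairP].
Qed.

Definition prod_coded : coded S (T * T') := Coded prod_enc_inj prod_codeP.

End Prod.

Section Tuple.
Context (T : Type) (c : coded S T).

Fixpoint tuple_enc p : ('I_p.+1 -> T) -> S :=
  match p with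
  | 0%N => fun a => c (a ord0)
  | q.+1 => fun a =>
      opair hS (c (a ord0)) (tuple_enc (fun i : 'I_q.+1 => a (lift ord0 i)))
  end.

Fixpoint tuple_code p : S :=
  if p is q.+1 then prods hS (code c) (tuple_code q) else code c.

Lemma tuple_enc_inj p : injective (@tuple_enc p).
Proof.
elim: p => [|p IH] a b /= e; apply/funext => i.
  by rewrite ord1; apply: (enc_inj e).
have := opairP hS (c (a ord0)) (tuple_enc (fun i : 'I_p.+1 => a (lift ord0 i))).
rewrite e => h; have [e0 /IH e1] := opair_inj h (opairP hS _ _).
have [j ->|->] := unliftP ord0 i; last exact: enc_inj e0.
by have /(congr1 (fun f => f j)) := e1.
Qed.

Lemma tuple_codeP p u :
  u ∈ tuple_code p <-> exists a : 'I_p.+1 -> T, tuple_enc a = u.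
Proof.
elim: p u => [|p IH] u /=.
  split=> [/codeP[x <-]|[a <-]]; [by exists (fun=> x)|exact: code_enc].
split=> [/prodsP[x [y [/codeP[a <-] [/IH[b <-] /opairE ->]]]]|[a <-]].
  exists (fun i => if unlift ord0 i is Some j then b j else a).
  rewrite unlift_none; congr (opair _ _ (tuple_enc _)).
  by apply/funext => i; rewrite liftK.
apply/prodsP; exists (c (a ord0)), (tuple_enc (fun i => a (lift ord0 i))).
split; first exact: code_enc.
by split; [apply/IH; eexists|exact: opairP].
Qed.

Definition tuple_coded p : coded S ('I_p.+1 -> T) :=
  Coded (@tuple_enc_inj p) (@tuple_codeP p).

End Tuple.

Section Graph.
Context (T T' : Type) (c : coded S T) (c' : coded S T').

Lemma graph_maps (f : T -> T') F x y : graph_of c c' f F ->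
  maps F (c x) y <-> y = c' (f x).
Proof.
move=> hF; split=> [[z [hz /hF[x' hz']]]|->].
  by have [e ->] := opair_inj hz hz'; rewrite (enc_inj e).
exists (opair hS (c x) (c' (f x))); split; first exact: opairP.
by apply/hF; exists x; exact: opairP.
Qed.

Lemma graph_is_fun (f : T -> T') F :
  graph_of c c' f F -> is_fun F (code c) (code c').
Proof.
move=> hF; split; [|split].
- move=> z /hF[x hz]; exists (c x), (c' (f x)); split; first exact: code_enc.
  by split=> //; exact: code_enc.
- by move=> x /codeP[a <-]; exists (c' (f a)); apply/(graph_maps a _ hF).
- move=> x y z [p [hp Fp]]; have /hF[a ha] := Fp.
  have [-> _] := opair_inj hp ha.
  have h1 : maps F (c a) y.
    by exists p; split=> //; have [<- _] := opair_inj hp ha.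
  move/(graph_maps a y hF): h1 => -> /(graph_maps a z hF) -> //.
Qed.

Lemma is_fun_graph F : is_fun F (code c) (code c') ->
  exists f : T -> T', graph_of c c' f F.
Proof.
move=> hF.
have H x : exists y, maps F (c x) (c' y).
  have [y xy] := hF.2.1 _ (code_enc c x).
  by have [_ /codeP[b hb]] := maps_dom hF xy; exists b; rewrite hb.
have [f hf] := choice H; exists f => z; split.
  move=> Fz; have [a [b [/codeP[x <-] [/codeP[y <-] o]]]] := hF.1 z Fz.
  exists x; suff <- : c' y = c' (f x) by [].
  by apply: hF.2.2 (hf x); exists z.
by move=> [x hz]; have [p [hp Fp]] := hf x; rewrite (opair_fun hS hz hp).
Qed.

Lemma graph_inj (f g : T -> T') F :
  graph_of c c' f F -> graph_of c c' g F -> f = g.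
Proof.
move=> hf hg; apply/funext => x; apply: (@enc_inj _ _ c').
by apply/(graph_maps x _ hg); apply/(graph_maps x _ hf).
Qed.

End Graph.
End Coded.

Section InternalMaps.
Context (N : nonstandard_universe).
Local Notation V := (intU N).
Let hV := pairing_intU N.

Lemma internal_of_graph (T T' : Type) (c : coded V T) (c' : coded V T')
    (f : T -> T') F : is_fun F (code c) (code c') ->
  (forall x, maps F (c x) (c' (f x))) -> internal c c' f.
Proof.
move=> hF fF; have [g hg] := is_fun_graph hV hF.
suff -> : f = g by exists F.
apply/funext => x; apply: (@enc_inj _ _ c'); symmetry.
exact: hF.2.2 ((graph_maps hV x _ hg).2 erefl) (fF x).
Qed.

Lemma internal_id (T : Type) (c : coded V T) : internal c c id.
Proof.
have [F [hF mF]] := int_id (code c).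
by apply: (internal_of_graph hF) => x; apply: mF; exact: code_enc.
Qed.

Lemma internal_comp (T1 T2 T3 : Type) (c1 : coded V T1) (c2 : coded V T2)
    (c3 : coded V T3) (g : T2 -> T3) (f : T1 -> T2) :
  internal c2 c3 g -> internal c1 c2 f -> internal c1 c3 (g \o f).
Proof.
move=> [F2 h2] [F1 h1].
have [F [hF mF]] := int_comp (graph_is_fun hV h1) (graph_is_fun hV h2).
apply: (internal_of_graph hF) => x; apply: (mF _ (c2 (f x))).
  exact/(graph_maps hV x _ h1).
exact/(graph_maps hV _ _ h2).
Qed.

Lemma internal_tuple_proj (T : Type) (c : coded V T) p (i : 'I_p.+1) :
  internal (tuple_coded hV c p) c (fun a => a i).
Proof.
elim: p i => [|p IH] i.
  have [F [hF mF]] := int_id (code c).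
  apply: (internal_of_graph (F := F)) => // a.
  by rewrite (ord1 i); apply: mF; exact: code_enc.
have [F1 [F2 [h1 [h2 m12]]]] := int_proj (prodsP hV (code c) (tuple_code hV c p)).
have m a := m12 _ _ _ (code_enc (tuple_coded hV c p.+1) a) (opairP hV _ _).
have [j ->|->] := unliftP ord0 i; last first.
  by apply: (internal_of_graph (F := F1)) => // a; exact: (m a).1.
apply: (@internal_comp _ _ _ _ (tuple_coded hV c p) _ (fun b => b j)
  (fun a k => a (lift ord0 k))); first exact: IH.
by apply: (internal_of_graph (F := F2)) => // a; exact: (m a).2.
Qed.

Lemma internal_tuple (D T : Type) (d : coded V D) (c : coded V T) p
    (u : 'I_p.+1 -> D -> T) : (forall i, internal d c (u i)) ->
  internal d (tuple_coded hV c p) (fun a i => u i a).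
Proof.
elim: p u => [|p IH] u hu.
  have [F hF] := hu ord0.
  apply: (internal_of_graph (F := F)); first exact (graph_is_fun hV hF).
  by move=> x; exact ((graph_maps hV x _ hF).2 erefl).
have [F1 h1] := hu ord0.
have [F2 h2] := IH (fun i => u (lift ord0 i)) (fun i => hu (lift ord0 i)).
have [F [hF mF]] := int_pair (prodsP hV (code c) (tuple_code hV c p))
  (graph_is_fun hV h1) (graph_is_fun hV h2).
apply: (internal_of_graph (F := F)) => // x.
apply: (mF (d x) (c (u ord0 x)) (tuple_enc hV c (fun i => u (lift ord0 i) x))).
- exact/(graph_maps hV x _ h1).
- exact/(graph_maps hV x _ h2).
- exact: opairP.
Qed.

Lemma internal_reindex (T T' : Type) (c : coded V T) (c' : coded V T')
    (f : T -> T') p q (r : 'I_q.+1 -> 'I_p.+1) : internal c c' f ->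
  internal (tuple_coded hV c p) (tuple_coded hV c' q) (fun a i => f (a (r i))).
Proof.
move=> hf; apply: (@internal_tuple _ _ _ _ q (fun i a => f (a (r i)))) => i.
exact: (internal_comp hf (internal_tuple_proj c (r i))).
Qed.

End InternalMaps.

Section HyperfiniteSums.
Context (N : nonstandard_universe) (G : zmod_in (intU N)).
Local Notation V := (intU N).
Local Notation hV := (pairing_intU N).
Local Notation zG := (zelt hV G).
Local Notation cG := (elem_coded (zcarrier G) : coded V zG).

(** [c : T -> G] is the formal sum of [g_i s_i] for [i < n], with [n] a hypernatural
    number and [g], [s] internal sequences, all [s_i] being in the possibly external
    set [Q]. For [n = 0] this is the zero chain. *)
Definition hyperfinite_sum (T : Type) (cT : coded V T) (Q : set T)
    (c : T -> zG) : Prop :=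
  exists n g s k : V, [/\ graph_of cT cG c k,
    formal_sum (zcarrier G) (zadd G) (code cT) n g s k &
    forall i x, maps s i (cT x) -> Q x].

(** [push phi] is the homomorphism determined by [x |-> phi x]: it maps the
    hyperfinite sum of [g_i s_i] to that of [g_i (phi s_i)]. The default value 0 of
    [xget] is not used on hyperfinite sums when [phi] is internal, see [pushP] and
    [pushes_fun]. *)
Definition pushes (T T' : Type) (cT : coded V T) (cT' : coded V T')
    (phi : T -> T') (c : T -> zG) (d : T' -> zG) : Prop :=
  exists n g s h k l : V, [/\ graph_of cT cG c k, graph_of cT' cG d l,
    formal_sum (zcarrier G) (zadd G) (code cT) n g s k,
    formal_sum (zcarrier G) (zadd G) (code cT') n g h l &
    forall i x, maps s i (cT x) -> maps h i (cT' (phi x))].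

Definition push (T T' : Type) (cT : coded V T) (cT' : coded V T')
    (phi : T -> T') (c : T -> zG) : T' -> zG :=
  xget 0 [set d | pushes cT cT' phi c d].

Section Theory.
Context (T T' : Type) (cT : coded V T) (cT' : coded V T').
Local Notation fsum := (formal_sum (zcarrier G) (zadd G)).

Lemma formal_sum_fun A n g s c : fsum A n g s c ->
  [/\ is_nat n, is_fun g n (zcarrier G), is_fun s n A & is_fun c A (zcarrier G)].
Proof. by move=> [? [? [? [? _]]]]; split. Qed.

Lemma hyperfinite_sum0 Q : hyperfinite_sum cT Q (0 : T -> zG).
Proof.
have [n [g [s [k [hk [hs k0]]]]]] := int_sum_zero (code cT) (zmod_inP G).
exists n, g, s, k; split=> //; last by move=> i x /hs.
have [_ _ _ fk] := formal_sum_fun hk.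
have [c hc] := is_fun_graph hV (c := cT) (c' := cG) fk.
suff <- : c = 0 :> (T -> zG) by [].
apply/funext => x; apply: elem_inj; apply/(is_zeroE hV G).
by apply: (k0 (cT x)); apply/(graph_maps hV x _ hc).
Qed.

Lemma hyperfinite_sumB Q (c d : T -> zG) :
  hyperfinite_sum cT Q c -> hyperfinite_sum cT Q d ->
  hyperfinite_sum cT Q (c - d).
Proof.
move=> [n [g [s [k [gk hk Qs]]]]] [n1 [g1 [s1 [k1 [gk1 hk1 Qs1]]]]].
have [n2 [g2 [s2 [k2 [hk2 [rs [e _]]]]]]] := int_sum_sub (zmod_inP G) hk hk1.
exists n2, g2, s2, k2; split=> //; last first.
  by move=> i x /rs[j [/Qs|/Qs1]].
have [_ _ _ fk] := formal_sum_fun hk2.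
have [b hb] := is_fun_graph hV (c := cT) (c' := cG) fk.
suff -> : c - d = b by [].
apply/funext => x; have := e (cT x) _ _ _ ((graph_maps hV x _ gk).2 erefl)
  ((graph_maps hV x _ gk1).2 erefl) ((graph_maps hV x _ hb).2 erefl).
move=> /(opE (hS := hV) (d x) (b x) (c x))/elem_inj cE.
by rewrite [LHS](_ : _ = c x - d x) // cE addrC addKr.
Qed.

Lemma hyperfinite_sum_sub (Q Q' : set T) c : Q `<=` Q' ->
  hyperfinite_sum cT Q c -> hyperfinite_sum cT Q' c.
Proof.
move=> QQ' [n [g [s [k [gk hk Qs]]]]]; exists n, g, s, k.
by split=> // i x /Qs/QQ'.
Qed.

Context (phi : T -> T') (hphi : internal cT cT' phi).

Lemma pushes_ex (Q : set T) (Q' : set T') c : (forall x, Q x -> Q' (phi x)) ->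
  hyperfinite_sum cT Q c -> exists2 d, pushes cT cT' phi c d &
  hyperfinite_sum cT' Q' d.
Proof.
move=> QQ' [n [g [s [k [gk hk Qs]]]]]; have [F hF] := hphi.
have [nn gg ss kk] := formal_sum_fun hk.
have [h [hh mh]] := int_comp ss (graph_is_fun hV hF).
have [l hl] := int_sum_ex (zmod_inP G) nn gg hh.
have [_ _ _ fl] := formal_sum_fun hl.
have [d hd] := is_fun_graph hV (c := cT') (c' := cG) fl.
have sh i x : maps s i (cT x) -> maps h i (cT' (phi x)).
  by move=> ix; apply: mh ix _; apply/(graph_maps hV x _ hF).
exists d; first by exists n, g, s, h, k, l.
exists n, g, h, l; split=> // i y iy.
have [j ij] := ss.2.1 i (maps_dom hh iy).1.
have [_ /codeP[x xj]] := maps_dom ss ij; subst j.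
have e := hh.2.2 _ _ _ iy (sh _ _ ij); rewrite (enc_inj e).
exact/QQ'/Qs/ij.
Qed.

Lemma pushesB c d c1 d1 : pushes cT cT' phi c d -> pushes cT cT' phi c1 d1 ->
  pushes cT cT' phi (c - c1) (d - d1).
Proof.
have [F hF] := hphi; have fF := graph_is_fun hV hF.
have sF s h A : is_fun s A (code cT) ->
    (forall i x, maps s i (cT x) -> maps h i (cT' (phi x))) -> pushes_seq s F h.
  move=> hs sh i x y ix; have [_ /codeP[a xa]] := maps_dom hs ix.
  by subst x => /(graph_maps hV a _ hF) ->; exact: sh.
move=> [n [g [s [h [k [l [gk gl hk hl sh]]]]]]].
move=> [n1 [g1 [s1 [h1 [k1 [l1 [gk1 gl1 hk1 hl1 sh1]]]]]]].
have [n2 [g2 [s2 [k2 [hk2 [rs [e e']]]]]]] := int_sum_sub (zmod_inP G) hk hk1.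
have [nn2 gg2 ss2 fk2] := formal_sum_fun hk2.
have [h2 [hh2 mh2]] := int_comp ss2 fF.
have [l2 hl2] := int_sum_ex (zmod_inP G) nn2 gg2 hh2.
have [_ _ _ fl2] := formal_sum_fun hl2.
have [_ _ ss _] := formal_sum_fun hk; have [_ _ ss1 _] := formal_sum_fun hk1.
have {}e' := e' _ _ _ _ _ _ _ _ fF (sF _ _ _ ss sh) (sF _ _ _ ss1 sh1) mh2
  hl hl1 hl2.
have [b hb] := is_fun_graph hV (c := cT) (c' := cG) fk2.
have [b' hb'] := is_fun_graph hV (c := cT') (c' := cG) fl2.
have -> : c - c1 = b.
  apply/funext => x; have := e (cT x) _ _ _ ((graph_maps hV x _ gk).2 erefl)
    ((graph_maps hV x _ gk1).2 erefl) ((graph_maps hV x _ hb).2 erefl).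
  move=> /(opE (hS := hV) (c1 x) (b x) (c x))/elem_inj cE.
  by rewrite [LHS](_ : _ = c x - c1 x) // cE addrC addKr.
have -> : d - d1 = b'.
  apply/funext => x; have := e' (cT' x) _ _ _ ((graph_maps hV x _ gl).2 erefl)
    ((graph_maps hV x _ gl1).2 erefl) ((graph_maps hV x _ hb').2 erefl).
  move=> /(opE (hS := hV) (d1 x) (b' x) (d x))/elem_inj dE.
  by rewrite [LHS](_ : _ = d x - d1 x) // dE addrC addKr.
exists n2, g2, s2, h2, k2, l2; split=> // i x ix.
by apply: mh2 ix _; apply/(graph_maps hV x _ hF).
Qed.

Lemma pushes0 d : pushes cT cT' phi 0 d -> d = 0.
Proof.
have [F hF] := hphi; have fF := graph_is_fun hV hF.
move=> [n [g [s [h [k [l [gk gl hk hl sh]]]]]]].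
have [_ _ ss fk] := formal_sum_fun hk.
have sF : pushes_seq s F h.
  move=> i x y ix; have [_ /codeP[a xa]] := maps_dom ss ix.
  by subst x => /(graph_maps hV a _ hF) ->; exact: sh.
have k0 t y : maps k t y -> is_zero (zcarrier G) (zadd G) y.
  move=> ty; have [/codeP[a ta] _] := maps_dom fk ty; subst t.
  by move/(graph_maps hV a _ gk) : ty => ->; apply/(is_zeroE hV G).
have := int_sum_push0 (zmod_inP G) hk k0 fF sF hl.
move=> l0; apply/funext => x; apply: elem_inj; apply/(is_zeroE hV G).
by apply: (l0 (cT' x)); apply/(graph_maps hV x _ gl).
Qed.

Lemma pushes_fun c d d' :
  pushes cT cT' phi c d -> pushes cT cT' phi c d' -> d = d'.
Proof.
move=> h h'; have := pushesB h h'; rewrite subrr => /pushes0 dd.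
by apply/eqP; rewrite -subr_eq0 dd.
Qed.

Lemma pushE c d : pushes cT cT' phi c d -> push cT cT' phi c = d.
Proof.
move=> h; apply: xget_unique => //.
by move=> d' h'; exact: (pushes_fun h' h).
Qed.

Lemma pushP (Q : set T) c : hyperfinite_sum cT Q c ->
  pushes cT cT' phi c (push cT cT' phi c).
Proof.
by move=> /(@pushes_ex Q setT c)[//|d hd _]; rewrite (pushE hd).
Qed.

Lemma hyperfinite_sum_push (Q : set T) (Q' : set T') c :
  (forall x, Q x -> Q' (phi x)) ->
  hyperfinite_sum cT Q c -> hyperfinite_sum cT' Q' (push cT cT' phi c).
Proof. by move=> QQ' /(pushes_ex QQ')[d /pushE ->]. Qed.

Lemma pushB Q Q1 c c1 : hyperfinite_sum cT Q c -> hyperfinite_sum cT Q1 c1 ->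
  push cT cT' phi (c - c1) = push cT cT' phi c - push cT cT' phi c1.
Proof. by move=> /pushP h /pushP h1; apply: pushE; exact: pushesB. Qed.

End Theory.

Lemma push_comp (T1 T2 T3 : Type) (c1 : coded V T1) (c2 : coded V T2)
    (c3 : coded V T3) (psi : T2 -> T3) (phi : T1 -> T2) Q c :
  internal c2 c3 psi -> internal c1 c2 phi -> hyperfinite_sum c1 Q c ->
  push c2 c3 psi (push c1 c2 phi c) = push c1 c3 (psi \o phi) c.
Proof.
move=> hpsi hphi [n [g [s [k [gk hk Qs]]]]].
have [F1 h1] := hphi; have [F2 h2] := hpsi.
have [nn gg ss kk] := formal_sum_fun hk.
have [h [hh mh]] := int_comp ss (graph_is_fun hV h1).
have [l hl] := int_sum_ex (zmod_inP G) nn gg hh.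
have [_ _ _ fl] := formal_sum_fun hl.
have [d hd] := is_fun_graph hV (c := c2) (c' := cG) fl.
have [h' [hh' mh']] := int_comp hh (graph_is_fun hV h2).
have [l' hl'] := int_sum_ex (zmod_inP G) nn gg hh'.
have [_ _ _ fl'] := formal_sum_fun hl'.
have [d' hd'] := is_fun_graph hV (c := c3) (c' := cG) fl'.
have sh i x : maps s i (c1 x) -> maps h i (c2 (phi x)).
  by move=> ix; apply: mh ix _; apply/(graph_maps hV x _ h1).
have sh' i x : maps h i (c2 x) -> maps h' i (c3 (psi x)).
  by move=> ix; apply: mh' ix _; apply/(graph_maps hV x _ h2).
rewrite (@pushE _ _ _ _ _ hphi c d); last by exists n, g, s, h, k, l.
rewrite (@pushE _ _ _ _ _ hpsi d d'); last by exists n, g, h, h', l, l'.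
rewrite (@pushE _ _ _ _ _ (internal_comp hpsi hphi) c d') //.
by exists n, g, s, h', k, l'; split=> // i x /sh/sh'.
Qed.

End HyperfiniteSums.

Section StarSpaces.
Context (N : nonstandard_universe).
Local Notation U := (stdU N).
Local Notation V := (intU N).
Local Notation hU := (pairing_standard (stdU_standard N)).
Local Notation hV := (pairing_intU N).

Section Star.
Context (T : Type) (c : coded U T).

(** [hyper c] is [*T], [std_elem c x] is [*x], [hyper_set c A] is [*A]. *)
Definition hyper : Type := elem (star (code c)).
Definition hyper_coded : coded V hyper := elem_coded (star (code c)).

Lemma std_elem_mem (x : T) : star (c x) ∈ star (code c).
Proof. by apply/star_mem; exact: code_enc. Qed.
Definition std_elem (x : T) : hyper := Elem (std_elem_mem x).

Lemma subset_code_ex (A : set T) :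
  exists a : U, forall u, u ∈ a <-> exists2 x, A x & c x = u.
Proof.
have [a ha] := su_separation (stdU_standard N) (code c)
  (fun u => exists2 x, A x & c x = u).
exists a => u; split=> [/ha[]//|h]; apply/ha; split=> //.
by have [x _ <-] := h; exact: code_enc.
Qed.
Definition subset_code (A : set T) : U := projT1 (cid (subset_code_ex A)).

Definition hyper_set (A : set T) : set hyper :=
  [set x : hyper | x ∈ star (subset_code A)].

End Star.

(** Pairing, identifying [*T] x [*T'] with the star of [T * T']. *)
Definition hpair (T T' : Type) (c : coded U T) (c' : coded U T')
    (x : hyper c) (y : hyper c') : hyper (prod_coded hU c c').
Proof.
refine (@Elem _ _ (opair hV x y) _).
apply/(star_prod (prodsP hU (code c) (code c'))).
exists x, y; split; first exact: elemP.
by split; [exact: elemP|exact: opairP].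
Defined.

Definition inf_close (X : uniformType) (c : coded U X) (x y : hyper c) : Prop :=
  forall E : set (X * X), entourage E -> hyper_set E (hpair x y).

Definition S_continuous_at (X Y : uniformType) (cX : coded U X)
    (cY : coded U Y) (f : hyper cX -> hyper cY) (x : hyper cX) : Prop :=
  forall y, inf_close y x -> inf_close (f y) (f x).

(** S-continuous internal maps from [*X] to [*Y]. *)
Record S_map (X Y : uniformType) (cX : coded U X) (cY : coded U Y) := SMap {
  S_fun :> hyper cX -> hyper cY;
  S_fun_internal : internal (hyper_coded cX) (hyper_coded cY) S_fun;
  S_fun_continuous : forall x, S_continuous_at S_fun x }.

Definition maps_pair (X Y : uniformType) (cX : coded U X) (cY : coded U Y)
    (A : set X) (B : set Y) (f : S_map cX cY) : Prop :=
  forall x, hyper_set A x -> hyper_set B (f x).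

Section Homotopy.
Context (R : realType).

Definition unit_interval : uniformType := set_type [set` `[0 : R, 1]].

Lemma unit_interval0_subproof : (0 : R) \in [set` `[0 : R, 1]].
Proof. by rewrite inE /= in_itv /= lexx ler01. Qed.
Lemma unit_interval1_subproof : (1 : R) \in [set` `[0 : R, 1]].
Proof. by rewrite inE /= in_itv /= lexx ler01. Qed.
Definition I0 : unit_interval := exist _ 0 unit_interval0_subproof.
Definition I1 : unit_interval := exist _ 1 unit_interval1_subproof.

Context (cI : coded U unit_interval).
Context (X Y : uniformType) (cX : coded U X) (cY : coded U Y).

Definition S_homotopy (f g : S_map cX cY)
    (h : S_map (prod_coded hU cX cI : coded U (X * unit_interval)%type) cY) :=
  (forall x, h (hpair x (std_elem cI I0)) = f x) /\
  (forall x, h (hpair x (std_elem cI I1)) = g x).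

Definition S_homotopic (f g : S_map cX cY) : Prop := exists h, S_homotopy f g h.

Definition S_homotopic_pair (A : set X) (B : set Y) (f g : S_map cX cY) : Prop :=
  exists2 h, S_homotopy f g h &
    forall x t, hyper_set A x -> hyper_set B (h (hpair x t)).

End Homotopy.

Section MuHomology.
Context (G : zmod_in V).
Local Notation zG := (zelt hV G).

Section Microchains.
Context (X : uniformType) (cX : coded U X) (p : nat).

Definition simplex := 'I_p.+1 -> hyper cX.
Definition simplex_coded : coded V simplex := tuple_coded hV (hyper_coded cX) p.

Definition microsimplex : set simplex :=
  [set s | forall i j, inf_close (s i) (s j)].
Definition simplex_in (A : set X) : set simplex :=
  [set s | forall i, hyper_set A (s i)].

(** [microchain_pred A] is the group of [p]-microchains of [A], as a subgroup of the
    functions on the [p]-simplices of [*X]; [simplex_in setT] is vacuous, so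
    [microchain] is the group of all [p]-microchains of [X]. *)
Definition microchain_pred (A : set X) : {pred (simplex -> zG)} :=
  fun c => `[< hyperfinite_sum simplex_coded
                 (microsimplex `&` simplex_in A) c >].

Lemma microchain_pred_zmod_closed A : zmod_closed (microchain_pred A).
Proof.
split; first by apply/asboolP; exact: hyperfinite_sum0.
by move=> c d /asboolP hc /asboolP hd; apply/asboolP; exact: hyperfinite_sumB.
Qed.
HB.instance Definition _ A := GRing.isZmodClosed.Build (simplex -> zG)
  (microchain_pred A) (microchain_pred_zmod_closed A).

Record microchain := Microchain {
  microchain_val :> simplex -> zG;
  _ : microchain_val \in microchain_pred setT }.
HB.instance Definition _ := [isSub for microchain_val].
HB.instance Definition _ := [Choice of microchain by <:].
HB.instance Definition _ := [SubChoice_isSubZmodule of microchain by <:].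

Lemma microchainP (c : microchain) : microchain_val c \in microchain_pred setT.
Proof. by case: c. Qed.

Lemma microchain_inj : injective microchain_val.
Proof. exact: val_inj. Qed.

Definition microchain_in (A : set X) : {pred microchain} :=
  fun c => microchain_val c \in microchain_pred A.
Lemma microchain_in_zmod_closed A : zmod_closed (microchain_in A).
Proof. by split=> [|c d]; [exact: rpred0|exact: rpredB]. Qed.
HB.instance Definition _ A := GRing.isZmodClosed.Build microchain
  (microchain_in A) (microchain_in_zmod_closed A).

Lemma simplex_inT s : simplex_in setT s.
Proof.
move=> i /=; rewrite /hyper_set /=.
suff -> : subset_code cX setT = code cX by exact: elemP.
apply: (su_ext (stdU_standard N)) => u; rewrite /subset_code.
case: cid => a /= ->; rewrite codeP; split=> -[x]; [by exists x|].
by exists x.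
Qed.

End Microchains.

Section MicroPush.
Context (X Y : uniformType) (cX : coded U X) (cY : coded U Y) (p q : nat).
Context (phi : simplex cX p -> simplex cY q).
Context (phi_internal :
  internal (simplex_coded cX p) (simplex_coded cY q) phi).
Context (phi_micro : forall s, microsimplex s -> microsimplex (phi s)).

Local Notation pushf := (push (simplex_coded cX p) (simplex_coded cY q) phi).

Lemma push_pred (A : set X) (B : set Y) (c : simplex cX p -> zG) :
  (forall s, simplex_in A s -> simplex_in B (phi s)) ->
  c \in microchain_pred A -> pushf c \in microchain_pred B.
Proof.
move=> AB /asboolP hc; apply/asboolP.
apply: hyperfinite_sum_push hc => // s [ms As].
by split; [exact: phi_micro|exact: AB].
Qed.

Lemma micro_push_subproof (c : microchain cX p) :
  pushf c \in microchain_pred setT.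
Proof.
by apply: push_pred (microchainP c) => s _; exact: simplex_inT.
Qed.

Definition micro_push (c : microchain cX p) : microchain cY q :=
  Microchain (micro_push_subproof c).

Lemma micro_push_is_zmod_morphism : zmod_morphism micro_push.
Proof.
move=> c d; apply: val_inj; rewrite raddfB /=.
have /asboolP hc := microchainP c; have /asboolP hd := microchainP d.
exact: pushB hc hd.
Qed.
HB.instance Definition _ := GRing.isZmodMorphism.Build
  (microchain cX p) (microchain cY q) micro_push micro_push_is_zmod_morphism.

Lemma micro_push_in (A : set X) (B : set Y) (c : microchain cX p) :
  (forall s, simplex_in A s -> simplex_in B (phi s)) ->
  c \in microchain_in A -> micro_push c \in microchain_in B.
Proof. by move=> AB; exact: push_pred. Qed.

End MicroPush.

Lemma micro_push_comp (X Y Z : uniformType) (cX : coded U X) (cY : coded U Y)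
    (cZ : coded U Z) (p q r : nat) (phi : simplex cX p -> simplex cY q)
    (psi : simplex cY q -> simplex cZ r) ih mh ih' mh' (c : microchain cX p) :
  microchain_val (@micro_push _ _ _ _ _ _ psi ih' mh'
    (@micro_push _ _ _ _ _ _ phi ih mh c)) =
  push (simplex_coded cX p) (simplex_coded cZ r) (psi \o phi) c.
Proof. by have /asboolP hc := microchainP c; exact: push_comp hc. Qed.

Section Complex.
Context (X : uniformType) (cX : coded U X).

Definition face p (j : 'I_p.+2) (s : simplex cX p.+1) : simplex cX p :=
  fun i => s (lift j i).

Lemma face_internal p (j : 'I_p.+2) :
  internal (simplex_coded cX p.+1) (simplex_coded cX p) (face j).
Proof. exact: internal_reindex (internal_id (hyper_coded cX)). Qed.

Lemma face_micro p (j : 'I_p.+2) (s : simplex cX p.+1) :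
  microsimplex s -> microsimplex (face j s).
Proof. by move=> hs i k; exact: hs. Qed.

Definition boundary p (c : microchain cX p.+1) : microchain cX p :=
  \sum_(j < p.+2)
    micro_push (@face_internal p j) (@face_micro p j) c *~ (-1) ^+ j.

Lemma boundary_is_zmod_morphism p : zmod_morphism (@boundary p).
Proof.
move=> c d; rewrite /boundary -sumrB; apply: eq_bigr => j _.
by rewrite raddfB mulrzBl.
Qed.
HB.instance Definition _ p := GRing.isZmodMorphism.Build
  (microchain cX p.+1) (microchain cX p) (@boundary p)
  (@boundary_is_zmod_morphism p).

Lemma alternating_sum0 (M : zmodType) n (a : nat -> nat -> M) :
  (forall i j, (i <= j)%N -> (j < n)%N -> a i j.+1 = a j i) ->
  \sum_(i < n) \sum_(j < n.+1) a i j *~ ((-1) ^+ j * (-1) ^+ i) = 0.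
Proof.
move=> ha; pose f i j := a i j *~ ((-1) ^+ j * (-1) ^+ i).
have split_j (i : 'I_n) : \sum_(j < n.+1) f i j =
    \sum_(j < n) (if (j <= i)%N then f i j else 0) -
    \sum_(j < n) (if (i <= j)%N then f j i else 0).
  have -> : \sum_(j < n.+1) f i j =
      \sum_(j < n.+1) (if (j <= i)%N then f i j else 0) +
      \sum_(j < n.+1) (if (i < j)%N then f i j else 0).
    rewrite -big_split /=; apply: eq_bigr => j _.
    by case: leqP; rewrite ?addr0 ?add0r.
  congr (_ + _).
    by rewrite big_ord_recr /= leqNgt ltn_ord addr0.
  rewrite big_ord_recl /= add0r -sumrN; apply: eq_bigr => j _.
  rewrite ltnS; case: ifP => ij; last by rewrite oppr0.
  rewrite /f /bump /= add1n ha //.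
  by rewrite exprS mulN1r mulNr mulrC mulrNz.
rewrite (eq_bigr _ (fun i _ => split_j i)) sumrB.
by rewrite [X in _ - X]exchange_big subrr.
Qed.

Lemma boundary_boundary p (c : microchain cX p.+2) : boundary (boundary c) = 0.
Proof.
pose d (i j : nat) := micro_push (@face_internal p (inord i)) (@face_micro p (inord i))
  (micro_push (@face_internal p.+1 (inord j)) (@face_micro p.+1 (inord j)) c).
rewrite -[RHS](@alternating_sum0 _ p.+2 d).
  apply: eq_bigr => i _; rewrite raddf_sum mulrz_suml; apply: eq_bigr => j _.
  by rewrite raddfMz -mulrzA /d !inord_val.
move=> i j ij jp; apply: microchain_inj; rewrite !micro_push_comp.
congr (push _ _ _ _); apply/funext => s; apply/funext => k /=.
rewrite /face; congr (s _); apply: val_inj; rewrite /= !inordK; try lia.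
by rewrite /bump; lia.
Qed.

(** [M(X; G)], its subcomplex [M(A; G)] and the quotient [M(X, A; G)]. *)
Definition mu_complex : chain_complex := ChainComplex boundary_boundary.

Lemma boundary_in (A : set X) p (c : microchain cX p.+1) :
  c \in microchain_in A -> boundary c \in microchain_in A.
Proof.
move=> hc; apply: rpred_sum => j _; apply: rpredMz; apply: micro_push_in hc.
by move=> s hs i; exact: hs.
Qed.

Definition mu_subcomplex (A : set X) : subcomplex mu_complex :=
  @Subcomplex mu_complex (fun p => microchain_in A) (@boundary_in A).

Definition mu_relative (A : set X) : chain_complex :=
  quotient_complex (mu_subcomplex A).

End Complex.

Section ChainMaps.
Context (X Y : uniformType) (cX : coded U X) (cY : coded U Y).
Context (f : S_map cX cY).

Definition simplex_map p (s : simplex cX p) : simplex cY p := fun i => f (s i).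

Lemma simplex_map_internal p :
  internal (simplex_coded cX p) (simplex_coded cY p) (@simplex_map p).
Proof. exact: (@internal_reindex _ _ _ _ _ f p p id (S_fun_internal f)). Qed.

Lemma simplex_map_micro p (s : simplex cX p) :
  microsimplex s -> microsimplex (simplex_map s).
Proof. by move=> hs i j; exact: S_fun_continuous (hs i j). Qed.

Lemma micro_push_boundary p (c : microchain cX p.+1) :
  micro_push (@simplex_map_internal p) (@simplex_map_micro p) (boundary c) =
  boundary (micro_push (@simplex_map_internal p.+1) (@simplex_map_micro p.+1) c).
Proof.
rewrite raddf_sum; apply: eq_bigr => j _; rewrite raddfMz; congr (_ *~ _).
by apply: microchain_inj; rewrite !micro_push_comp.
Qed.

Definition mu_map : chain_map (mu_complex cX) (mu_complex cY) :=
  @ChainMap (mu_complex cX) (mu_complex cY)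
    (fun p => micro_push (@simplex_map_internal p) (@simplex_map_micro p))
    micro_push_boundary.

Context (A : set X) (B : set Y) (fAB : maps_pair A B f).

Lemma mu_map_in p (c : mu_complex cX p) :
  c \in mu_subcomplex cX A p -> mu_map p c \in mu_subcomplex cY B p.
Proof. by apply: micro_push_in => s hs i; exact: fAB. Qed.

Definition mu_map_relative : chain_map (mu_relative cX A) (mu_relative cY B) :=
  quotient_chain_map mu_map_in.

End ChainMaps.
End MuHomology.
End StarSpaces.

(* Main.v *)
Require Import Defs.
From HB Require Import structures.
From mathcomp Require Import all_boot all_order all_algebra.
From mathcomp Require Import all_classical all_reals all_analysis.
From mathcomp Require Import zify.
Set Implicit Arguments.
Unset Strict Implicit.
Unset Printing Implicit Defensive.
Import Order.TTheory GRing.Theory Num.Theory.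
Import numFieldNormedType.Exports.
Local Open Scope classical_set_scope.
Local Open Scope ring_scope.
Local Notation is_fun := Defs.is_fun.
Local Notation code := Defs.code.

(** Saturation gives a hyperfinite subdivision [0 = t_0, ..., t_n = 1] of [*[0, 1]]
    with infinitely close consecutive points. Over each step [[t_k, t_(k+1)]] the
    classical prism operator sends microsimplices to microchains, because the
    homotopy is S-continuous, and it is a chain homotopy from [h(-, t_k)] to
    [h(-, t_(k+1))]. Summing over [k < n] telescopes to a chain homotopy from [f]
    to [g]. The hyperfinite sum over [k] is expressed as the image of the cylinder
    [c x n] under an internal map of simplices. *)

(** A single prism over all of [*[0, 1]] would join h(x, 0) to h(x, 1), which need not be infinitely
    close, so its simplices need not be microsimplices. The steps must be infinitesimal, and their
    number n is then an infinite hypernatural number. That the sum over k < n is again a microchain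
    cannot be shown by induction on n: being a microsimplex is an external property, and induction
    along the hypernatural numbers applies to internal properties only. Everything that involves n
    is therefore packed into one hyperfinite sum indexed by pairs (term of c, level). The
    microsimplex condition is then checked simplex by simplex, and telescoping becomes an equality
    of two chains on the product with {0, ..., n}, read off coefficient by coefficient. What this
    requires of formal sums is first order, so it is proved with ordinary finite sums in the
    standard universe and transferred. *)

(** * Signs in the prism identity; chain homotopies on homology and on quotients *)

(** To be read with [a i j] the i-th face of the j-th prism, [b i j] the j-th prism over the i-th
    face, and [w j] the face shared by the prisms j - 1 and j. The faces off the two diagonals
    cancel against the second sum; the diagonal ones telescope. *)
Lemma prism_alternating_sum (M : zmodType) p (a b : nat -> nat -> M)
    (w : nat -> M) :
  (forall i j, (i < j <= p)%N -> a i j = b i j.-1) ->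
  (forall i j, (j.+1 < i <= p.+1)%N -> a i j = b i.-1 j) ->
  (forall j, (j <= p)%N -> a j j = w j) ->
  (forall j, (j <= p)%N -> a j.+1 j = w j.+1) ->
  \sum_(i < p.+2) \sum_(j < p.+1) a i j *~ ((-1) ^+ j * (-1) ^+ i) +
  \sum_(j < p) \sum_(i < p.+1) b i j *~ ((-1) ^+ i * (-1) ^+ j) =
  w 0%N - w p.+1.
Proof.
move=> ha1 ha2 hd hs.
pose f i j := a i j *~ ((-1) ^+ j * (-1) ^+ i).
have sgn j : (-1 : int) ^+ j * (-1) ^+ j = 1 by rewrite -exprMn mulrNN mulr1 expr1n.
(* The entries [f j j] and [f j.+1 j] are split off. Beyond them the row index is lowered by one, so
   that both remaining sums run over [i < p.+1], as for [b]. *)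
have col j : (j <= p)%N -> \sum_(i < p.+2) f i j =
    (\sum_(i < p.+1) (if (i < j)%N then f i j else 0) +
     \sum_(i < p.+1) (if (j < i)%N then f i.+1 j else 0)) + (w j - w j.+1).
  move=> jp; have jp1 : (j < p.+1)%N by []; have jp2 : (j < p.+2)%N by exact: leqW.
  have fjj : f j j = w j by rewrite /f hd // sgn mulr1z.
  have fj1 : f j.+1 j = - w j.+1.
    by rewrite /f hs // exprS mulN1r mulrN sgn mulrNz mulr1z.
  have -> : \sum_(i < p.+2) f i j =
      \sum_(i < p.+2) (if (i < j)%N then f i j else 0) +
      \sum_(i < p.+2) (if (j < i)%N then f i j else 0) + f j j.
    rewrite (bigD1 (inord j)) //= inordK //.
    rewrite [X in _ = X + _ + _](bigD1 (inord j)) //= inordK // ltnn add0r.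
    rewrite [X in _ = _ + X + _](bigD1 (inord j)) //= inordK // ltnn add0r.
    rewrite -big_split addrC; congr (_ + _); apply: eq_bigr => i.
    rewrite -val_eqE /= inordK // => ij.
    by case: ltngtP ij; rewrite ?addr0 ?add0r.
  rewrite big_ord_recr /= ltnNge (leq_trans jp _) // addr0.
  rewrite [X in _ + X + _]big_ord_recl /= add0r.
  rewrite [X in _ + X + _](bigD1 (inord j)) //= inordK // /bump /= add1n ltnSn.
  rewrite [X in _ = _ + X + _](bigD1 (inord j)) //= inordK // ltnn add0r.
  rewrite fjj fj1.
  rewrite -!addrA; congr (_ + _).
  rewrite [- w _ + _]addrC -addrA; congr (_ + _).
  apply: eq_bigr => i; rewrite -val_eqE /= inordK // add1n ltnS => ij.
  by rewrite leq_eqVlt eq_sym (negbTE ij).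
rewrite exchange_big /=.
rewrite (eq_bigr _ (fun (j : 'I_p.+1) _ => col j (leq_ord j))) 2!big_split /=.
have -> : \sum_(j < p.+1) (w j - w j.+1) = w 0%N - w p.+1.
  have := @telescope_sumr _ 0%N p.+1 (fun i => - w i) (leq0n _).
  rewrite big_mkord addrC opprK => <-.
  by apply: eq_bigr => j _; rewrite opprK addrC.
(* The column 0 has no row i < 0 and the column p no row i > p. Without them both sums run over
   [j < p], and each [b i j] meets exactly one term of opposite sign: [f i.+1 j] if j < i,
   [f i j.+1] otherwise. *)
rewrite big_ord_recl /= big1_eq add0r.
rewrite [X in _ + X + _ + _]big_ord_recr /=.
rewrite [X in _ + (_ + X) + _ + _]big1 ?addr0; last first.
  by move=> i _; rewrite ltnNge leq_ord.
rewrite addrAC -[RHS]add0r; congr (_ + _).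
rewrite -!big_split /= big1 // => j _; rewrite -!big_split /= big1 // => i _.
rewrite /bump /= add1n ltnS leqNgt; have [ji|ij] := ltnP j i.
  rewrite add0r /f (ha2 _ _ _) /=; last by rewrite ltnS ji ltn_ord.
  by rewrite exprS mulN1r mulrN mulrC mulrNz addNr.
rewrite addr0 /f (ha1 _ _ _) /=; last by rewrite ltnS ij ltn_ord.
by rewrite exprS mulN1r mulNr mulrC mulrNz addNr.
Qed.

Lemma homology_map_homotopic (C D : chain_complex) (f g : chain_map C D) p :
  chain_homotopic f g -> homology_map f p =1 homology_map g p.
Proof.
move=> [h [h0 hS]] x; rewrite -[x]reprK /homology_map /= !quot_mapE;
  try exact: cycle_fun_boundaries.
apply/eqP; rewrite eq_sym -Quotient.idealrBE.
case: (repr x) => z zc; apply/asboolP.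
exists (h p z) => /=.
case: p x z zc => [|p] _ z zc; first exact: h0.
by rewrite hS (eqP zc) raddf0 addr0.
Qed.

(** The operator is an argument rather than a witness hidden in [chain_homotopic], because it
    descends to the quotients only if it carries [S] into [T]. *)
Lemma quotient_chain_homotopic (C D : chain_complex) (S : subcomplex C)
    (T : subcomplex D) (f g : chain_map C D)
    (fST : forall p c, c \in S p -> f p c \in T p)
    (gST : forall p c, c \in S p -> g p c \in T p)
    (h : forall p, {additive C p -> D p.+1}) :
  (forall p c, c \in S p -> h p c \in T p.+1) ->
  (forall c : C 0%N, g 0%N c - f 0%N c = bdry D (h 0%N c)) ->
  (forall p (c : C p.+1),
     g p.+1 c - f p.+1 c = bdry D (h p.+1 c) + h p (bdry C c)) ->
  chain_homotopic (quotient_chain_map fST) (quotient_chain_map gST).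
Proof.
move=> hST h0 hS; exists (fun p => quot_mapA (hST p)).
split=> [c|p c]; rewrite -[c]reprK /= !quot_mapE;
  do ?exact: subcx_bdry; do ?exact: fST; do ?exact: gST; do ?exact: hST.
  by rewrite !reprK -raddfB h0.
by rewrite !reprK -raddfB hS raddfD.
Qed.

(** * First-order facts on formal sums and natural numbers, with their transfer *)

(** The functions [proj] and [lev] identify [m'] with [m] x [n]; they do not depend
    on the chain, so that the cylinders over a chain and over its image under a map
    are indexed in the same way. *)
Definition fact_sum_cylinder (S : sets) : Prop := forall G a m n g : S,
  is_zmod G a -> is_nat m -> is_nat n -> is_fun g m G ->
  exists m' g' proj lev, is_fun proj m' m /\ is_fun lev m' n /\
    forall A P s c, is_prod A n P -> formal_sum G a A m g s c ->
    exists s' c', formal_sum G a P m' g' s' c' /\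
      (forall i j k x q, maps proj i j -> maps lev i k -> maps s j x ->
         is_opair x k q -> maps s' i q) /\
      (forall x k q v, q ∈ P -> is_opair x k q -> maps c x v -> maps c' q v).

(** The coefficient of an image at a point is the sum over the fibre of that point. Telescoping
    meets only fibres with at most one point, the two cases singled out here. *)
Definition fact_sum_push_inj (S : sets) : Prop :=
  forall G a A B n g s c f h d : S,
  is_zmod G a -> formal_sum G a A n g s c -> is_fun f A B ->
  pushes_seq s f h -> formal_sum G a B n g h d ->
  (forall x y v, maps f x y -> (forall x', maps f x' y -> x' = x) ->
     maps c x v -> maps d y v) /\
  (forall y v, (forall x, ~ maps f x y) -> maps d y v -> is_zero G a v).

(** The maps [incl] and [shift] send the step [t_i, t_(i+1)] to the indices of its two ends among
    the n + 1 subdivision points. *)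
Definition fact_nat_shift (S : sets) : Prop := forall n m : S,
  is_nat n -> is_succ n m ->
  (exists z, is_empty z /\ z ∈ m) /\ ~ n ∈ n /\
  exists incl shift, is_fun incl n m /\ is_fun shift n m /\
    (forall i j, maps incl i j <-> i ∈ n /\ i = j) /\
    (forall i j, maps shift i j <-> i ∈ n /\ is_succ i j) /\
    (forall i i' j, maps shift i j -> maps shift i' j -> i = i') /\
    (forall i j, maps shift i j -> ~ is_empty j) /\
    (forall j, j ∈ m -> is_empty j \/ exists i, maps shift i j).

Section StandardFacts.
Context (S : sets) (hU : standard_universe S).
Let hS := pairing_standard hU.
Local Notation num := (Defs.num hU).

Lemma std_sum_cylinder : fact_sum_cylinder S.
Proof.
move=> G a m n g hG /(is_natP hU)[k ->] /(is_natP hU)[l ->] hg.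
pose G' := ZmodIn hG; have [g' gE] := zseqP (G := G') hg.
(* An index below [l * k] encodes a term [i %% k] of the chain and a level [i %/ k], so each level
   is a block of [k] consecutive indices. *)
have rk i : (i < l * k)%N -> (i %% k < k)%N.
  by move=> il; rewrite ltn_mod; case: (k) il => //; rewrite muln0.
have ql i : (i < l * k)%N -> (i %/ k < l)%N.
  by move=> il; rewrite ltn_divLR //; case: (k) il => //; rewrite muln0.
have [g2 [hg2 g2E]] := @seq_mk S hU G (fun i => g' (i %% k)%N : zelt hS G')
  (l * k)%N (fun i _ => elemP _).
have [pr [hpr prE]] : exists f, is_fun f (num (l * k)) (num k) /\
    forall i, (i < l * k)%N -> maps f (num i) (num (i %% k)).
  apply: (@seq_mk S hU _ (fun i => num (i %% k))) => i /rk ?.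
  by apply/mem_num; exists (i %% k)%N.
have [lv [hlv lvE]] : exists f, is_fun f (num (l * k)) (num l) /\
    forall i, (i < l * k)%N -> maps f (num i) (num (i %/ k)).
  apply: (@seq_mk S hU _ (fun i => num (i %/ k))) => i /ql ?.
  by apply/mem_num; exists (i %/ k)%N.
exists (num (l * k)), g2, pr, lv; split=> //; split=> // A P s c hP hc.
have [_ [_ [hs [hfc _]]]] := hc; have [s' sE] := seqP hs.
have [/(_ hc)[_ cE] _] := @formal_sumP S hU G' A k g s c g' s' hg hs gE sE.
pose w i := opair hS (s' (i %% k)%N) (num (i %/ k)).
have [s2 [hs2 s2E]] : exists f, is_fun f (num (l * k)) P /\
    forall i, (i < l * k)%N -> maps f (num i) (w i).
  apply: (@seq_mk S hU _ w) => i il; apply/hP.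
  exists (s' (i %% k)%N), (num (i %/ k)); split.
    exact: (maps_dom hs (sE _ (rk i il))).2.
  split; last exact: opairP.
  by apply/mem_num; exists (i %/ k)%N => //; exact: ql.
have [c2 [hc2 c2E]] := @chain_mk S hU G' P
  (fun t => \sum_(i < l * k) tcoef w (fun i => g' (i %% k)%N) t i).
exists s2, c2; split.
  apply/(@formal_sumP S hU G' P (l * k) g2 s2 c2 (fun i => g' (i %% k)%N) w) => //.
  split=> // t y ty; exact: hc2.2.2 ty (c2E t (maps_dom hc2 ty).1).
split=> [i j x y q ij ix jy hq|x y q v Pq hq xv].
  have /mem_num[i' il ii] := (maps_dom hpr ij).1; subst i.
  have ? := hpr.2.2 _ _ _ ij (prE _ il); have ? := hlv.2.2 _ _ _ ix (lvE _ il).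
  subst j x; rewrite (hs.2.2 _ _ _ jy (sE _ (rk _ il))) in hq.
  by rewrite (opairE hS hq); exact: s2E.
have {xv}-> : v = \sum_(i < k) tcoef s' g' x i by exact: cE.
have /hP[x' [y' [_ [/mem_num[r rl yr] hq']]]] := Pq.
have [? ?] := opair_inj hq hq'; subst x' y' y => {hq'}.
suff -> : \sum_(i < k) tcoef s' g' x i =
    \sum_(i < l * k) tcoef w (fun i => g' (i %% k)%N) q i by exact: c2E.
have block b : \sum_(i < k) tcoef w (fun i => g' (i %% k)%N) q (b * k + i)%N =
    if b == r then \sum_(i < k) tcoef s' g' x i else 0.
  have -> : (if b == r then \sum_(i < k) tcoef s' g' x i else 0) =
      \sum_(i < k) (if b == r then tcoef s' g' x i else 0).
    by case: eqP => // _; rewrite big1.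
  apply: eq_bigr => i _.
  have k0 : (0 < k)%N by apply: leq_ltn_trans (ltn_ord i).
  rewrite /tcoef /w modnMDl divnMDl // modn_small // divn_small // addn0.
  have wE : opair hS (s' i) (num b) = q <-> s' i = x /\ b = r.
    split=> [e|[-> ->]]; last by symmetry; exact: opairE.
    have ho := opairP hS (s' i) (num b); rewrite e in ho.
    by have [-> /num_inj] := opair_inj ho hq.
  case: asboolP => [/wE[e ->]|ne]; first by rewrite eqxx asboolT.
  by case: eqP => // br; case: asboolP => // sx; case: ne; apply/wE.
(* Induction on the number of levels, available because the sum is finite here: the partial sum
   jumps from 0 to the coefficient of [c] at [x] once the level [r] of [q] is passed. *)
have blocks b : \sum_(i < b * k) tcoef w (fun i => g' (i %% k)%N) q i =
    if (r < b)%N then \sum_(i < k) tcoef s' g' x i else 0.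
  elim: b => [|b IH]; first by rewrite mul0n big_ord0.
  rewrite mulSnr big_split_ord /= IH block [in RHS]ltnS [in RHS]leq_eqVlt.
  have [->|br] := eqVneq b r; first by rewrite ltnn add0r.
  by rewrite addr0.
by rewrite blocks rl.
Qed.

Lemma std_sum_push_inj : fact_sum_push_inj S.
Proof.
move=> G a A B n g s c f h d hG hc hf sh hd; pose G' := ZmodIn hG.
have [k [g' [s' [nk gE sE sA cE]]]] := std_sumP hU hG hc; subst n.
have [_ [_ [_ [hfc _]]]] := hc.
have [_ [hg [hh [hfd _]]]] := hd; have [h' hE] := seqP hh.
have [/(_ hd)[_ dE] _] := @formal_sumP S hU G' B k g h d g' h' hg hh gE hE.
have hsE i : (i < k)%N -> maps f (s' i) (h' i).
  move=> ik; have [y sy] := hf.2.1 _ (sA i ik).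
  by rewrite (hh.2.2 _ _ _ (hE i ik) (sh _ _ _ (sE i ik) sy)).
split=> [x y v xy inj xv|y v im0 /dE ->].
  have [v' yv] := hfd.2.1 y (maps_dom hf xy).2.
  suff -> : v = v' by [].
  rewrite (cE _ _ xv) (dE _ _ yv); congr elem_val; apply: eq_bigr => i _.
  rewrite /tcoef; case: asboolP => e; case: asboolP => e' //.
    by case: e'; apply: hf.2.2 xy; rewrite -e; exact: hsE.
  by case: e; apply: inj; rewrite -e'; exact: hsE.
apply/(@is_zeroE S hS G'); congr elem_val; rewrite big1 // => i _.
by rewrite /tcoef asboolF // => e; apply: (im0 (s' i)); rewrite -e; exact: hsE.
Qed.

Lemma std_nat_shift : fact_nat_shift S.
Proof.
move=> n m /(is_natP hU)[k ->] /(succE hU) ->; change (nsucc hU (num k)) with (num k.+1).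
split; first by exists (num 0); split; [exact: num0|apply/mem_num; exists 0%N].
split; first by move=> /mem_num[j jk /num_inj e]; rewrite e ltnn in jk.
have [||f [hf mf]] := @fun_graph S hU (num k) (num k.+1) (fun x y => x = y).
- move=> x /mem_num[j jk ->]; exists (num j); split=> //.
  by apply/mem_num; exists j => //; exact: ltnW.
- by move=> x y z ->.
have [||g [hg mg]] := @fun_graph S hU (num k) (num k.+1) (fun x y => is_succ x y).
- move=> x /mem_num[j jk ->]; exists (num j.+1); split; last exact: nsuccP.
  by apply/mem_num; exists j.+1.
- by move=> x y z /(succE hU) -> /(succE hU) ->.
have mgE i j : maps g i j -> exists2 i', i = num i' & j = num i'.+1.
  by move=> /mg[/mem_num[i' _ ->] _ /(succE hU)->]; exists i'.
exists f, g; split=> //; split=> //; split.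
  move=> i j; split=> [/mf[]//|[ik ij]]; apply/mf; split=> //.
  by apply/mem_num; move: ik => /mem_num[i' ik e]; exists i'; [exact: ltnW|rewrite -ij].
split.
  move=> i j; split=> [/mg[]//|[ik ij]]; apply/mg; split=> //.
  rewrite (succE hU ij); move: ik => /mem_num[i' ik ->].
  by apply/mem_num; exists i'.+1.
split.
  by move=> i i' j /mgE[r -> ->] /mgE[r' -> /num_inj[->]].
split; first by move=> i j /mgE[r _ ->] /(Defs.emptyE hU) /num_inj.
move=> j /mem_num[[|r] rk ->]; first by left; exact: num0.
right; exists (num r); apply/mg; split; [| |exact: nsuccP].
  by apply/mem_num; exists r.
by apply/mem_num; exists r.+1.
Qed.

End StandardFacts.

Section Transfer.
Context (N : nonstandard_universe).
Local Notation V := (intU N).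

Lemma int_sum_cylinder : fact_sum_cylinder V.
Proof.
apply: transfer (std_sum_cylinder (stdU_standard N)).
by unfold fact_sum_cylinder; solve_definable.
Qed.

Lemma int_sum_push_inj : fact_sum_push_inj V.
Proof.
apply: transfer (std_sum_push_inj (stdU_standard N)).
by unfold fact_sum_push_inj, pushes_seq; solve_definable.
Qed.

Lemma int_nat_shift : fact_nat_shift V.
Proof.
apply: transfer (std_nat_shift (stdU_standard N)).
by unfold fact_nat_shift; solve_definable.
Qed.

End Transfer.

(** * Infinite closeness and fine subdivisions of the unit interval *)

Lemma unit_interval_chain (R : realType)
    (E : set (unit_interval R * unit_interval R)) : entourage E ->
  exists k (v : nat -> unit_interval R), [/\ v 0%N = I0 R, v k = I1 R &
    forall i, (i < k)%N -> E (v i, v i.+1)].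
Proof.
move=> [W entW WE].
have [e /= e0 eW] : exists2 e : R, 0 < e & forall x y : R, `|x - y| < e -> W (x, y).
  move: entW; rewrite -entourage_from_ballE => -[e /= e0 eW].
  by exists e => // x y xy; apply: eW.
(* The mesh 1/k has to be smaller than [e]; the successor makes [k] visibly positive, for the
   divisions. *)
pose k := (Num.bound e^-1).+1.
have k0 : (0 : R) < k%:R by rewrite ltr0n.
have ke : k%:R^-1 < e.
  rewrite invf_plt ?posrE // /k -natr1; apply: lt_le_trans (archi_boundP _) _.
    by rewrite invr_ge0 ltW.
  by rewrite lerDl.
have [v vE] : exists v : nat -> unit_interval R,
    forall i, (i <= k)%N -> set_val (v i) = i%:R / k%:R.
  suff H i : exists x : unit_interval R, (i <= k)%N -> set_val x = i%:R / k%:R.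
    by have [v vE] := choice H; exists v.
  have [ik|ik] := leqP i k; last by exists (I0 R).
  have iI : (i%:R / k%:R : R) \in [set` `[(0 : R), 1]].
    rewrite inE /= in_itv /= divr_ge0 // ler_pdivrMr // mul1r ler_nat //.
  by exists (exist _ (i%:R / k%:R) iI).
exists k, v; split.
- by apply: val_inj; rewrite [LHS]vE //= mul0r.
- by apply: val_inj; rewrite [LHS]vE //= divff // gt_eqF.
- move=> i ik; apply: WE; apply: eW; rewrite /= !vE //; last exact: ltnW.
  rewrite -mulrBl -natr1 opprD addrA subrr add0r mulN1r normrN gtr0_norm //.
  by rewrite invr_gt0.
Qed.

Section InfinitelyClose.
Context (N : nonstandard_universe).
Local Notation U := (stdU N).
Local Notation V := (intU N).
Local Notation hU := (pairing_standard (stdU_standard N)).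
Local Notation hV := (pairing_intU N).

Lemma subset_codeP (T : Type) (c : coded U T) (A : set T) u :
  u ∈ subset_code c A <-> exists2 x, A x & c x = u.
Proof. exact: (projT2 (cid (subset_code_ex c A))). Qed.

Lemma star_push_env (x : U) e : star \o push_env x e = push_env (star x) (star \o e).
Proof. by apply/funext => -[|n]. Qed.

Lemma inf_closeE (X : uniformType) (c : coded U X) (x y : hyper c) :
  inf_close x y <-> forall E : set (X * X), entourage E ->
    opair hV x y ∈ star (subset_code (prod_coded hU c c) E).
Proof. by []. Qed.

(** Infinite closeness is external and is not transferred as a whole. For one entourage at a time
    the property is first order with standard parameters, and this is what transfers, here and in
    the next two lemmas. *)
Lemma inf_close_refl (X : uniformType) (c : coded U X) (x : hyper c) :
  inf_close x x.
Proof.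
apply/inf_closeE => E entE.
have d : definable (fun (S : sets) e => forall x p : S,
    x ∈ e 0%N -> is_opair x x p -> p ∈ e 1%N) by solve_definable.
have [h _] := transfer_env
  (push_env (code c) (fun=> subset_code (prod_coded hU c c) E)) d.
apply: h (elemP x) (opairP _ _ _) => _ p /codeP[a <-] hp; apply/subset_codeP.
exists (a, a); first exact: entourage_refl.
by rewrite [RHS](opairE hU hp).
Qed.

Lemma inf_close_sym (X : uniformType) (c : coded U X) (x y : hyper c) :
  inf_close x y -> inf_close y x.
Proof.
move=> /inf_closeE xy; apply/inf_closeE => E entE.
have {xy} := xy _ (entourage_inv entE).
have d : definable (fun (S : sets) e => forall x y p q : S,
    is_opair x y p -> is_opair y x q -> p ∈ e 0%N -> q ∈ e 1%N).
  by solve_definable.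
have [h _] := transfer_env (push_env (subset_code (prod_coded hU c c) E^-1%relation)
  (fun=> subset_code (prod_coded hU c c) E)) d.
apply: h; [|exact: opairP|exact: opairP] => {}x {}y p q hp hq /subset_codeP[].
move=> [a b] /= ab e; rewrite -e in hp.
have [? ?] := opair_inj hp (opairP hU (c a) (c b)); subst x y.
by apply/subset_codeP; exists (b, a) => //; rewrite [RHS](opairE hU hq).
Qed.

(** An entourage of the product contains a product of entourages up to exchanging the two middle
    coordinates; the transferred sentence performs this exchange on pairs. *)
Lemma inf_close_pair (X Y : uniformType) (c : coded U X) (c' : coded U Y)
    (x x' : hyper c) (y y' : hyper c') :
  inf_close x x' -> inf_close y y' ->
  @inf_close N (X * Y)%type (prod_coded hU c c') (hpair x y) (hpair x' y').
Proof.
move=> /inf_closeE xx' /inf_closeE yy'; apply/inf_closeE => E entE.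
have [[E1 E2] /= [entE1 entE2] E12] := entE.
have {xx'} := xx' _ entE1; have {yy'} := yy' _ entE2.
have d : definable (fun (S : sets) e => forall x x' y y' p q r s t : S,
    is_opair y y' q -> is_opair x x' p -> is_opair x y r -> is_opair x' y' s ->
    is_opair r s t -> q ∈ e 1%N -> p ∈ e 0%N -> t ∈ e 2%N).
  by solve_definable.
have [h _] := transfer_env
  (push_env (subset_code (prod_coded hU c c) E1)
  (push_env (subset_code (prod_coded hU c' c') E2)
  (fun=> subset_code (prod_coded hU (prod_coded hU c c') (prod_coded hU c c')) E))) d.
apply: h; try exact: opairP; try exact: (opairP hV x y);
  try exact: (opairP hV x' y').
move=> {}x {}x' {}y {}y' p q r s t hq hp hr hs ht.
move=> /subset_codeP[[b b'] /= bb' eq] /subset_codeP[[a a'] /= aa' ep].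
rewrite -eq in hq; rewrite -ep in hp.
have [? ?] := opair_inj hq (opairP hU (c' b) (c' b')); subst y y'.
have [? ?] := opair_inj hp (opairP hU (c a) (c a')); subst x x'.
apply/subset_codeP; exists ((a, b), (a', b')).
  have [|[[u1 u2] [w1 w2]] /= Euw [? ? ? ?]] := E12 ((a, a'), (b, b')); first by [].
  by subst.
by rewrite [RHS](opairE hU ht) (opairE hU hr) (opairE hU hs).
Qed.

Lemma hyper_subdivision (R : realType) (c : coded U (unit_interval R)) :
  exists n m t : V, [/\ is_nat n, is_succ n m, is_fun t m (star (code c)) &
    [/\ forall z, is_empty z -> maps t z (star (c (I0 R))),
      maps t n (star (c (I1 R))) &
      forall i j (x y : hyper c), i ∈ n -> is_succ i j ->
        maps t i x -> maps t j y -> inf_close x y]].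
Proof.
(* The length [n] is realized together with [t], so that it does not depend on the
   entourage. *)
pose sub (S : sets) (e : nat -> S) := exists n t m : S,
  is_opair n t (e 0%N) /\ is_nat n /\ is_succ n m /\ is_fun t m (e 1%N) /\
  (forall z, is_empty z -> maps t z (e 2%N)) /\ maps t n (e 3%N) /\
  forall i j x y p, i ∈ n -> is_succ i j -> maps t i x -> maps t j y ->
    is_opair x y p -> p ∈ e 4%N.
have dsub : definable sub by rewrite /sub; solve_definable.
pose ent (E : set (unit_interval R * unit_interval R)) :=
  subset_code (prod_coded hU c c) E.
pose env (E : set (unit_interval R * unit_interval R)) : nat -> U :=
  push_env (code c) (push_env (c (I0 R)) (push_env (c (I1 R)) (fun=> ent E))).
(* Saturation is indexed by the elements of [U], so entourages are indexed by their codes, and by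
   [setT] where there is none. Only the code of [Ej j] matters, as [env] depends on the entourage
   through [ent] alone. *)
have [Ej EjP] : exists Ej : U -> set (unit_interval R * unit_interval R),
    forall j, entourage (Ej j) /\ forall E, entourage E -> ent E = j -> ent (Ej j) = j.
  suff H j : exists E', entourage E' /\
      forall E, entourage E -> ent E = j -> ent E' = j.
    by have [Ej EjP] := choice H; exists Ej.
  have [[E [entE <-]]|h] := pselect (exists E, entourage E /\ ent E = j).
    by exists E.
  exists setT; split; first exact: entourageT.
  by move=> E entE Ej; case: h; exists E.
have [phi phiP] := dsub.
have std E : entourage E -> exists x, sub U (push_env x (env E)).
  move=> /unit_interval_chain[k [v [v0 vk vE]]].
  have hS := stdU_standard N.
  have [t [ht tE]] := @seq_mk _ hS (code c) (fun i => c (v i)) k.+1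
    (fun i _ => code_enc c (v i)).
  exists (opair hU (Defs.num hS k) t), (Defs.num hS k), t, (Defs.num hS k.+1).
  split; first exact: opairP.
  split; first by apply/is_natP; exists k.
  split; first exact: nsuccP.
  split; first exact: ht.
  split; first by move=> z /(Defs.emptyE hS) ->; rewrite /= -v0; exact: (tE 0%N).
  split; first by rewrite /= -vk; exact: tE.
  move=> _ j x y p /mem_num[i ik ->] /(succE hS) -> ix jy hp.
  have ? := ht.2.2 _ _ _ ix (tE i (leqW ik)).
  have ? := ht.2.2 _ _ _ jy (tE i.+1 ik); subst x y.
  apply/subset_codeP; exists (v i, v i.+1); first exact: vE.
  by rewrite [RHS](opairE hU hp).
have [x xP] : exists x : V, forall j, sat (push_env x (star \o env (Ej j))) phi.
  apply: (@intU_saturated N (fun=> phi) (fun j => star \o env (Ej j))) => J finJ.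
  have /finite_fsetP[D JD] : finite_set (J : set {classic U}) := finJ.
  (* Finitely many conditions reduce to the one for the intersection of their entourages, which the
     star of a standard subdivision satisfies. *)
  have entD : entourage (\bigcap_(j in J) Ej j).
    rewrite JD; apply: (@filter_bigI _ {classic U}) => j _; exact: (EjP j).1.
  have [y subD] := std _ entD.
  exists (star y) => j Jj; rewrite -star_push_env.
  apply/star_elementary/phiP.
  have [n [t [m [h1 [h2 [h3 [h4 [h5 [h6 h7]]]]]]]]] := subD.
  exists n, t, m; do 6!split=> //.
  move=> i i' a b p ni ii' ia ib hp.
  have /subset_codeP[q Dq qp] := h7 _ _ _ _ _ ni ii' ia ib hp.
  by apply/subset_codeP; exists q => //; apply: Dq.
have {xP}xP j : sub V (push_env x (star \o env (Ej j))) by apply/phiP; exact: xP.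
have [n [t [m [h1 [h2 [h3 [h4 [h5 [h6 _]]]]]]]]] := xP (ent setT).
exists n, m, t; split=> //; split=> // i j a b ni ij ia jb.
apply/inf_closeE => E entE.
have [n' [t' [m' [h1' [_ [_ [_ [_ [_ h7]]]]]]]]] := xP (ent E).
have [? ?] := opair_inj h1 h1'; subst n' t'.
have := h7 _ _ _ _ _ ni ij ia jb (opairP hV _ _).
by rewrite /= ((EjP (ent E)).2 E entE erefl).
Qed.

End InfinitelyClose.

(** * Internal maps into and out of products *)

Section InternalPairs.
Context (N : nonstandard_universe).
Local Notation U := (stdU N).
Local Notation V := (intU N).
Local Notation hU := (pairing_standard (stdU_standard N)).
Local Notation hV := (pairing_intU N).

Lemma internal_const (D T : Type) (d : coded V D) (c : coded V T) (a : T) :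
  internal d c (fun=> a).
Proof.
have [f [hf fE]] : exists f, is_fun f (code d) (code c) /\
    forall x, x ∈ code d -> maps f x (c a).
  (* The value may be nonstandard, so it is quantified over in the transferred sentence instead of
     being a parameter of it. *)
  have H : forall A B b : V, b ∈ B -> exists f, is_fun f A B /\
      forall x, x ∈ A -> maps f x b.
    apply: (@transfer N (fun S => forall A B b : S, b ∈ B -> exists f,
      is_fun f A B /\ forall x, x ∈ A -> maps f x b)); first by solve_definable.
    move=> A B b Bb.
    have [||f [hf mf]] := @fun_graph U (stdU_standard N) A B (fun _ y => y = b).
    - by move=> x Ax; exists b.
    - by move=> x y z -> ->.
    by exists f; split=> // x Ax; apply/mf.
  by apply: H; exact: code_enc.
by apply: (internal_of_graph hf) => x; apply: fE; exact: code_enc.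
Qed.

Section Pair.
Context (D T T' : Type) (d : coded V D) (c : coded V T) (c' : coded V T').

Lemma internal_pair (u : D -> T) (v : D -> T') : internal d c u ->
  internal d c' v -> internal d (prod_coded hV c c') (fun x => (u x, v x)).
Proof.
move=> [F1 h1] [F2 h2].
have [F [hF mF]] := int_pair (prodsP hV (code c) (code c'))
  (graph_is_fun hV h1) (graph_is_fun hV h2).
apply: (internal_of_graph (F := F)) => // x; apply: (mF _ (c (u x)) (c' (v x))).
- exact/(graph_maps hV x _ h1).
- exact/(graph_maps hV x _ h2).
- exact: opairP.
Qed.

Lemma internal_fst : internal (prod_coded hV c c') c fst.
Proof.
have [F1 [F2 [h1 [h2 m12]]]] := int_proj (prodsP hV (code c) (code c')).
apply: (internal_of_graph (F := F1)) => // x.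
exact: (m12 _ _ _ (code_enc (prod_coded hV c c') x) (opairP hV _ _)).1.
Qed.

Lemma internal_snd : internal (prod_coded hV c c') c' snd.
Proof.
have [F1 [F2 [h1 [h2 m12]]]] := int_proj (prodsP hV (code c) (code c')).
apply: (internal_of_graph (F := F2)) => // x.
exact: (m12 _ _ _ (code_enc (prod_coded hV c c') x) (opairP hV _ _)).2.
Qed.

End Pair.

Lemma internal_hpair (D T T' : Type) (d : coded V D) (c : coded U T)
    (c' : coded U T') (u : D -> hyper c) (v : D -> hyper c') :
  internal d (hyper_coded c) u -> internal d (hyper_coded c') v ->
  internal d (hyper_coded (prod_coded hU c c')) (fun x => hpair (u x) (v x)).
Proof.
move=> [F1 h1] [F2 h2].
have [F [hF mF]] := int_pair (star_prod (prodsP hU (code c) (code c')))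
  (graph_is_fun hV h1) (graph_is_fun hV h2).
apply: (internal_of_graph (F := F)) => // x.
apply: (mF _ (hyper_coded c (u x)) (hyper_coded c' (v x))).
- exact/(graph_maps hV x _ h1).
- exact/(graph_maps hV x _ h2).
- exact: opairP.
Qed.

End InternalPairs.

(** * Cylinders over hyperfinite chains and their telescoping *)

Section Cylinders.
Context (N : nonstandard_universe) (G : zmod_in (intU N)).
Local Notation V := (intU N).
Local Notation hV := (pairing_intU N).
Local Notation zG := (zelt hV G).
Local Notation cG := (elem_coded (zcarrier G) : coded V zG).

Section PushInj.
Context (T T' : Type) (cT : coded V T) (cT' : coded V T') (phi : T -> T').
Context (hphi : internal cT cT' phi) (Q : set T) (c : T -> zG).
Context (hc : hyperfinite_sum cT Q c).

Lemma push_inj :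
  (forall x, (forall x', phi x' = phi x -> x' = x) ->
     push cT cT' phi c (phi x) = c x) /\
  (forall y, (forall x, phi x <> y) -> push cT cT' phi c y = 0).
Proof.
have [n [g [s [h [k [l [gk gl hk hl sh]]]]]]] := pushP hphi hc.
have [F hF] := hphi; have fF := graph_is_fun hV hF.
have [_ _ ss _] := formal_sum_fun hk.
have sF : pushes_seq s F h.
  move=> i x y ix; have [_ /codeP[a xa]] := maps_dom ss ix.
  by subst x => /(graph_maps hV a _ hF) ->; exact: sh.
have [inj im0] := int_sum_push_inj (zmod_inP G) hk fF sF hl.
split=> [x phix|y yim]; apply: elem_inj.
  apply/esym/(graph_maps hV (phi x) _ gl); apply: (inj (cT x)).
  - exact/(graph_maps hV x _ hF).
  - move=> x' xx'; have [/codeP[a ax] _] := maps_dom fF xx'; subst x'.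
    congr (cT _); apply: phix.
    exact: (enc_inj (esym ((graph_maps hV a _ hF).1 xx'))).
  - exact/(graph_maps hV x _ gk).
apply/(is_zeroE hV G); apply: (im0 (cT' y)); last exact/(graph_maps hV y _ gl).
move=> x xy; have [/codeP[a ax] _] := maps_dom fF xy; subst x.
by apply: (yim a); exact: (enc_inj (esym ((graph_maps hV a _ hF).1 xy))).
Qed.

End PushInj.

(** When [K] is hyperfinite, the cylinder over a chain [c], whose value at [(x, k)]
    is [c x], is the hyperfinite sum of the [c x k] for [k] in [K]. *)
Definition cylinder (T K : Type) (c : T -> zG) : T * K -> zG := fun x => c x.1.

Section Cylinder.
Context (K : Type) (cK : coded V K) (nK : is_nat (code cK)).

Let cylinder_sum (T : Type) (cT : coded V T) (c : T -> zG) n g s k m' g' pr lv :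
  graph_of cT cG c k ->
  formal_sum (zcarrier G) (zadd G) (code cT) n g s k ->
  is_fun pr m' n -> is_fun lv m' (code cK) ->
  (forall A P s c, is_prod A (code cK) P ->
    formal_sum (zcarrier G) (zadd G) A n g s c ->
    exists s' c', formal_sum (zcarrier G) (zadd G) P m' g' s' c' /\
      (forall i j k x q, maps pr i j -> maps lv i k -> maps s j x ->
         is_opair x k q -> maps s' i q) /\
      (forall x k q v, q ∈ P -> is_opair x k q -> maps c x v -> maps c' q v)) ->
  exists s' c', [/\ graph_of (prod_coded hV cT cK) cG (@cylinder T K c) c',
    formal_sum (zcarrier G) (zadd G) (code (prod_coded hV cT cK)) m' g' s' c' &
    forall i j x a, maps pr i j -> maps lv i (cK a) ->
      maps s' i (prod_coded hV cT cK (x, a)) <-> maps s j (cT x)].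
Proof.
move=> gk hk hpr hlv H.
have [s' [c' [hc' [s'E c'E]]]] := H _ _ _ _ (prodsP hV (code cT) (code cK)) hk.
exists s', c'; have [_ _ ss' fc'] := formal_sum_fun hc'; split=> //.
  have [b hb] := @is_fun_graph _ hV _ _ (prod_coded hV cT cK) cG _ fc'.
  suff -> : cylinder c = b by [].
  apply/funext => -[x a]; apply: elem_inj.
  apply/(graph_maps hV (x, a) _ hb); apply: (c'E (cT x) (cK a)).
  - exact: (code_enc (prod_coded hV cT cK)).
  - exact: opairP.
  - exact/(graph_maps hV x _ gk).
move=> i j x a ij ia; split=> [ixa|jx]; last first.
  by apply: s'E ij ia jx _; exact: opairP.
have [_ _ ss _] := formal_sum_fun hk.
have [x' jx'] := ss.2.1 _ (maps_dom hpr ij).2.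
have := s'E _ _ _ _ _ ij ia jx' (opairP hV _ _).
move=> /(ss'.2.2 _ _ _ ixa) e.
have e1 := opairP hV (cT x) (cK a); rewrite /= /prod_enc /= in e; rewrite e in e1.
by have [-> _] := opair_inj e1 (opairP hV _ _).
Qed.

(** Each simplex of the cylinder is a simplex of [c] together with a level, so the possibly external
    [Q] is inherited term by term, without induction over the levels. *)
Lemma hyperfinite_sum_cylinder (T : Type) (cT : coded V T) (Q : set T) c :
  hyperfinite_sum cT Q c ->
  hyperfinite_sum (prod_coded hV cT cK) [set x | Q x.1] (@cylinder T K c).
Proof.
move=> [n [g [s [k [gk hk Qs]]]]]; have [nn gg ss _] := formal_sum_fun hk.
have [m' [g' [pr [lv [hpr [hlv H]]]]]] := int_sum_cylinder (zmod_inP G) nn nK gg.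
have [s' [c' [gc' hc' s'E]]] := cylinder_sum gk hk hpr hlv H.
exists m', g', s', c'; split=> // i [x a] ixa /=.
have [_ _ ss' _] := formal_sum_fun hc'; have mi := (maps_dom ss' ixa).1.
have [j ij] := hpr.2.1 i mi; have [k' ik'] := hlv.2.1 i mi.
have [_ /codeP[b bk']] := maps_dom hlv ik'; subst k'.
have [x' jx'] := ss.2.1 _ (maps_dom hpr ij).2.
have [_ /codeP[y yx']] := maps_dom ss jx'; subst x'.
have := ss'.2.2 _ _ _ ixa ((s'E _ _ y _ ij ik').2 jx').
move=> /(enc_inj (c := prod_coded hV cT cK))[-> _]; exact: Qs jx'.
Qed.

(** Both sides are sums over the same index set with the same coefficients, and at each index the
    simplices correspond under [phi] with the level kept. *)
Lemma push_cylinder (T T' : Type) (cT : coded V T) (cT' : coded V T') (Q : set T)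
    (phi : T -> T') c : internal cT cT' phi -> hyperfinite_sum cT Q c ->
  push (prod_coded hV cT cK) (prod_coded hV cT' cK)
    (fun x => (phi x.1, x.2)) (cylinder c) =
  cylinder (push cT cT' phi c).
Proof.
move=> hphi hc.
have [n [g [s [h [k [l [gk gl hk hl sh]]]]]]] := pushP hphi hc.
have [nn gg ss _] := formal_sum_fun hk.
have [m' [g' [pr [lv [hpr [hlv H]]]]]] := int_sum_cylinder (zmod_inP G) nn nK gg.
have [s' [c' [gc' hc' s'E]]] := cylinder_sum gk hk hpr hlv H.
have [h' [d' [gd' hd' h'E]]] := cylinder_sum gl hl hpr hlv H.
apply: pushE.
  apply: internal_pair; last exact: internal_snd.
  exact: (internal_comp hphi (internal_fst cT cK)).
exists m', g', s', h', c', d'; split=> // i [x a] ixa.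
have [_ _ ss' _] := formal_sum_fun hc'; have mi := (maps_dom ss' ixa).1.
have [j ij] := hpr.2.1 i mi; have [k' ik'] := hlv.2.1 i mi.
have [_ /codeP[b bk']] := maps_dom hlv ik'; subst k'.
have [x' jx'] := ss.2.1 _ (maps_dom hpr ij).2.
have [_ /codeP[y yx']] := maps_dom ss jx'; subst x'.
have := ss'.2.2 _ _ _ ixa ((s'E _ _ y _ ij ik').2 jx').
move=> /(enc_inj (c := prod_coded hV cT cK))[-> ->].
by apply/(h'E _ _ _ _ ij ik'); exact: sh.
Qed.

Section Ends.
Context (L : Type) (cL : coded V L) (T : Type) (cT : coded V T) (Q : set T).
Context (c : T -> zG) (hc : hyperfinite_sum cT Q c).
Local Notation pushL e := (push (prod_coded hV cT cK) (prod_coded hV cT cL)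
  (fun x : T * K => (x.1, e x.2)) (cylinder c)).

Let internal_snd_map (e : K -> L) : internal cK cL e ->
  internal (prod_coded hV cT cK) (prod_coded hV cT cL) (fun x => (x.1, e x.2)).
Proof.
move=> he; apply: internal_pair; first exact: internal_fst.
exact: (internal_comp he (internal_snd cT cK)).
Qed.

Let internal_end (l : L) : internal cT (prod_coded hV cT cL) (fun x => (x, l)).
Proof. by apply: internal_pair; [exact: internal_id|exact: internal_const]. Qed.

(** Over [l0] only the end contributes, over any other level only the image of [e]. Both maps into
    the product are injective, so no coefficients are added up. *)
Lemma push_cylinder_end (e : K -> L) (l0 : L) : internal cK cL e ->
  injective e -> (forall k, e k <> l0) -> (forall l, l = l0 \/ exists k, e k = l) ->
  pushL e + push cT (prod_coded hV cT cL) (fun x => (x, l0)) c = cylinder c.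
Proof.
move=> he einj el0 eim.
have [inj1 im1] := push_inj (internal_snd_map he) (hyperfinite_sum_cylinder hc).
have [inj2 im2] := push_inj (internal_end l0) hc.
apply/funext => -[x l].
have [->|[k <-]] := eim l.
  transitivity (pushL e (x, l0) +
    push cT (prod_coded hV cT cL) (fun x => (x, l0)) c (x, l0)) => //.
  rewrite im1 ?add0r; last by move=> [x' k] [_ /el0].
  by rewrite (inj2 x) // => x' [].
transitivity (pushL e (x, e k) +
  push cT (prod_coded hV cT cL) (fun x => (x, l0)) c (x, e k)) => //.
rewrite im2 ?addr0; last by move=> x' [_ /esym/el0].
by rewrite (inj1 (x, k)) // => -[x' k'] /= [-> /einj->].
Qed.

(* In [T * L], the image of [incl] and the end [top] make up the whole cylinder over
   [L], and so do the image of [shift] and the end [bot]. *)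
Lemma push_cylinder_telescope (incl shift : K -> L) (bot top : L) (T' : Type)
    (cT' : coded V T') (psi : T * L -> T') :
  internal cK cL incl -> internal cK cL shift ->
  internal (prod_coded hV cT cL) cT' psi ->
  injective incl -> injective shift ->
  (forall k, incl k <> top) -> (forall k, shift k <> bot) ->
  (forall l, l = top \/ exists k, incl k = l) ->
  (forall l, l = bot \/ exists k, shift k = l) ->
  push (prod_coded hV cT cK) cT' (fun x => psi (x.1, shift x.2)) (cylinder c) -
  push (prod_coded hV cT cK) cT' (fun x => psi (x.1, incl x.2)) (cylinder c) =
  push cT cT' (fun x => psi (x, top)) c - push cT cT' (fun x => psi (x, bot)) c.
Proof.
move=> hi hs hpsi inji injs ti bs imi ims.
have hcyl := hyperfinite_sum_cylinder hc.
have compL e (he : internal cK cL e) :=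
  push_comp hpsi (internal_snd_map he) hcyl.
have compT l := push_comp hpsi (internal_end l) hc.
have sumL e (he : internal cK cL e) :=
  hyperfinite_sum_push (Q' := setT) (internal_snd_map he) (fun _ _ => I) hcyl.
have sumT l := hyperfinite_sum_push (Q' := setT) (internal_end l) (fun _ _ => I) hc.
(* All four terms factor through chains on [T * L]. Since [push] is additive it suffices to compare
   there, where moving the negative terms across gives the full cylinder on either side. *)
rewrite -[push _ _ (fun x => psi (x.1, shift x.2)) _](compL shift hs).
rewrite -[push _ _ (fun x => psi (x.1, incl x.2)) _](compL incl hi).
rewrite -[push _ _ (fun x => psi (x, top)) _](compT top).
rewrite -[push _ _ (fun x => psi (x, bot)) _](compT bot).
rewrite -(pushB hpsi (sumL _ hs) (sumL _ hi)) -(pushB hpsi (sumT _) (sumT _)).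
congr (push _ _ _ _); apply/eqP; rewrite subr_eq addrAC -subr_eq opprK.
by rewrite push_cylinder_end // addrC push_cylinder_end.
Qed.

End Ends.
End Cylinder.
End Cylinders.

(** * Steps and points of the subdivision as internal maps *)

Section HyperfiniteSubdivision.
Context (N : nonstandard_universe).
Local Notation U := (stdU N).
Local Notation V := (intU N).
Local Notation hV := (pairing_intU N).

Lemma subdivision_maps (R : realType) (cI : coded U (unit_interval R)) :
  exists (n m : V) (incl shift : elem n -> elem m) (bot top : elem m)
    (t : elem m -> hyper cI),
  [/\ is_nat n,
    [/\ internal (elem_coded n) (elem_coded m) incl,
        internal (elem_coded n) (elem_coded m) shift &
        internal (elem_coded m) (hyper_coded cI) t],
    [/\ injective incl, forall k, incl k <> top &
        forall l, l = top \/ exists k, incl k = l],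
    [/\ injective shift, forall k, shift k <> bot &
        forall l, l = bot \/ exists k, shift k = l] &
    [/\ t bot = std_elem cI (I0 R), t top = std_elem cI (I1 R) &
        forall k, inf_close (t (incl k)) (t (shift k))]].
Proof.
have [n [m [tm [nn nm ht [t0 t1 tS]]]]] := hyper_subdivision cI.
have [[z [z0 mz]] [nnn [f [g [hf [hg [fE [gE [ginj [g0 gim]]]]]]]]]] :=
  int_nat_shift nn nm.
have [incl hi] := @is_fun_graph _ hV _ _ (elem_coded n) (elem_coded m) f hf.
have [shift hs] := @is_fun_graph _ hV _ _ (elem_coded n) (elem_coded m) g hg.
have [t tE] := @is_fun_graph _ hV _ _ (elem_coded m) (hyper_coded cI) tm ht.
have mi k : maps f (elem_val k) (elem_val (incl k)).
  exact: (graph_maps hV k _ hi).2.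
have ms k : maps g (elem_val k) (elem_val (shift k)).
  exact: (graph_maps hV k _ hs).2.
have inclE k : elem_val (incl k) = elem_val k.
  by have [_ <-] := (fE _ _).1 (mi k).
have mt l : maps tm (elem_val l) (elem_val (t l)).
  exact: (graph_maps hV l _ tE).2.
have mn : n ∈ m by apply/nm; right.
exists n, m, incl, shift, (Elem mz), (Elem mn), t; split=> //.
- by split; [exists f|exists g|exists tm].
- split=> [k k' /(congr1 (@elem_val _ _))|k /(congr1 (@elem_val _ _))|[l ml]].
  + by rewrite !inclE => /elem_inj.
  + by rewrite inclE /= => e; apply: nnn; rewrite -{1}e; exact: elemP.
  + have [nl|ln] := (nm l).1 ml; [right|by left; exact: elem_inj].
    by exists (Elem nl); apply: elem_inj; rewrite inclE.
- split=> [k k' e|k /(congr1 (@elem_val _ _)) /= e|[l ml]].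
  + by apply: elem_inj; apply: ginj (ms k) _; rewrite e; exact: ms.
  + by apply: (g0 _ _ (ms k)); rewrite e.
  + have [l0|[i il]] := gim l ml; [left|right].
      apply: elem_inj => /=; apply: (ps_ext hV) => x.
      by split=> [/l0|/z0].
    have ni := (maps_dom hg il).1; exists (Elem ni); apply: elem_inj.
    exact: hg.2.2 (ms (Elem ni)) il.
- split.
  + apply: elem_inj; exact: ht.2.2 (mt (Elem mz)) (t0 z z0).
  + apply: elem_inj; exact: ht.2.2 (mt (Elem mn)) t1.
  + move=> k; have [nk ks] := (gE _ _).1 (ms k).
    apply: tS nk ks _ (mt _); rewrite -inclE; exact: mt.
Qed.

End HyperfiniteSubdivision.

(** * The prism operator over a hyperfinite family of steps *)

Section Prism.
Context (N : nonstandard_universe) (G : zmod_in (intU N)) (R : realType).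
Local Notation U := (stdU N).
Local Notation V := (intU N).
Local Notation hU := (pairing_standard (stdU_standard N)).
Local Notation hV := (pairing_intU N).
Local Notation zG := (zelt hV G).
Context (cI : coded U (unit_interval R)).
Context (X Y : uniformType) (cX : coded U X) (cY : coded U Y).
Context (H : S_map (prod_coded hU cX cI : coded U (X * unit_interval R)%type) cY).
Context (K : Type) (cK : coded V K) (nK : is_nat (code cK)).
Context (lo hi : K -> hyper cI).
Context (hlo : internal cK (hyper_coded cI) lo).
Context (hhi : internal cK (hyper_coded cI) hi).
Context (lohi : forall k, inf_close (lo k) (hi k)).
Local Notation cS p := (simplex_coded cX p).
Local Notation cSK p := (prod_coded hV (simplex_coded cX p) cK).

Lemma homotopy_close (x y : hyper cX) (s t : hyper cI) :
  inf_close x y -> inf_close s t -> inf_close (H (hpair x s)) (H (hpair y t)).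
Proof. by move=> xy st; apply: S_fun_continuous; exact: inf_close_pair. Qed.

(** [(H(s_0, lo), ..., H(s_j, lo), H(s_j, hi), ..., H(s_p, hi))] *)
Definition prism p (j : nat) (x : simplex cX p * K) : simplex cY p.+1 := fun i =>
  if (i <= j)%N then H (hpair (x.1 (inord i)) (lo x.2))
  else H (hpair (x.1 (inord i.-1)) (hi x.2)).

(** This is (H(s_0, lo), ..., H(s_(j-1), lo), H(s_j, hi), ..., H(s_p, hi)), the common face of the
    prisms j - 1 and j when 0 < j <= p. All vertices are at [hi] for j = 0 and at [lo] for j = p +
    1. *)
Definition slice p (j : nat) (x : simplex cX p * K) : simplex cY p := fun i =>
  if (i < j)%N then H (hpair (x.1 i) (lo x.2)) else H (hpair (x.1 i) (hi x.2)).

Lemma internal_vertex p (i : 'I_p.+1) (u : K -> hyper cI) :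
  internal cK (hyper_coded cI) u ->
  internal (cSK p) (hyper_coded cY)
    (fun x : simplex cX p * K => H (hpair (x.1 i) (u x.2))).
Proof.
move=> hu; apply: (internal_comp (f := fun x : simplex cX p * K =>
  hpair (x.1 i) (u x.2)) (S_fun_internal H)).
apply: internal_hpair.
  apply: (internal_comp (c2 := cS p) (g := fun s : simplex cX p => s i) (f := fst)).
    exact: internal_tuple_proj.
  exact: internal_fst.
exact: (internal_comp hu (internal_snd _ _)).
Qed.

Lemma prism_internal p j : internal (cSK p) (simplex_coded cY p.+1) (@prism p j).
Proof.
apply: (@internal_tuple N _ _ (cSK p) (hyper_coded cY) p.+1
  (fun i x => @prism p j x i)) => i.
by rewrite /prism; case: (i <= j)%N; exact: internal_vertex.
Qed.

(** All vertices of one prism lie over a single step [x.2], so closeness of the two ends of that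
    step is enough. *)
Lemma prism_micro p j (x : simplex cX p * K) :
  microsimplex x.1 -> microsimplex (prism j x).
Proof.
move=> xm i k; rewrite /prism; case: ifP => _; case: ifP => _;
  apply: homotopy_close; try exact: xm; try exact: inf_close_refl.
  exact: lohi.
exact/inf_close_sym/lohi.
Qed.

Section PrismChain.
Context (p : nat) (j : nat).

Lemma push_prism_in (A : set X) (B : set Y) (c : simplex cX p -> zG) :
  (forall x t, hyper_set A x -> hyper_set B (H (hpair x t))) ->
  c \in microchain_pred A ->
  push (cSK p) (simplex_coded cY p.+1) (prism j) (cylinder c) \in
    microchain_pred B.
Proof.
move=> HAB /asboolP hc; apply/asboolP.
apply: hyperfinite_sum_push (hyperfinite_sum_cylinder nK hc).
  exact: prism_internal.
move=> x [xm xA]; split; first exact: prism_micro.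
by move=> i; rewrite /prism; case: ifP => _; exact: HAB.
Qed.

Lemma hyper_setT (x : hyper cY) : hyper_set setT x.
Proof. exact: (@simplex_inT _ _ _ 0 (fun=> x) ord0). Qed.

Lemma prism_chain_subproof (c : microchain G cX p) :
  push (cSK p) (simplex_coded cY p.+1) (prism j) (cylinder (microchain_val c)) \in
    microchain_pred setT.
Proof.
apply: push_prism_in (microchainP c) => x t _; exact: hyper_setT.
Qed.

Definition prism_chain (c : microchain G cX p) : microchain G cY p.+1 :=
  Microchain (prism_chain_subproof c).

Lemma prism_chain_is_zmod_morphism : zmod_morphism prism_chain.
Proof.
move=> c d; apply: val_inj; rewrite raddfB /=.
have /asboolP hc := microchainP c; have /asboolP hd := microchainP d.
rewrite -(pushB (@prism_internal p j) (hyperfinite_sum_cylinder nK hc)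
  (hyperfinite_sum_cylinder nK hd)).
by congr (push _ _ _ _); apply/funext.
Qed.
HB.instance Definition _ := GRing.isZmodMorphism.Build
  (microchain G cX p) (microchain G cY p.+1) prism_chain
  prism_chain_is_zmod_morphism.

End PrismChain.

Definition prism_sum p (c : microchain G cX p) : microchain G cY p.+1 :=
  \sum_(j < p.+1) prism_chain j c *~ (-1) ^+ j.

Lemma prism_sum_is_zmod_morphism p : zmod_morphism (@prism_sum p).
Proof.
move=> c d; rewrite /prism_sum -sumrB; apply: eq_bigr => j _.
by rewrite raddfB mulrzBl.
Qed.
HB.instance Definition _ p := GRing.isZmodMorphism.Build
  (microchain G cX p) (microchain G cY p.+1) (@prism_sum p)
  (@prism_sum_is_zmod_morphism p).

Lemma prism_sum_in p (A : set X) (B : set Y) (c : microchain G cX p) :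
  (forall x t, hyper_set A x -> hyper_set B (H (hpair x t))) ->
  c \in microchain_in A -> prism_sum c \in microchain_in B.
Proof.
move=> HAB cA; apply: rpred_sum => j _; apply: rpredMz.
exact: push_prism_in HAB cA.
Qed.

(** Omitting a vertex before the jump from [lo] to [hi] moves the jump down by one. The upper bound
    on [j] keeps the [inord] in [prism] away from its default value. *)
Lemma face_prism_lt p (i j : nat) : (i < j <= p.+1)%N ->
  face (inord i) \o @prism p.+1 j =
  @prism p j.-1 \o (fun x => (face (inord i) x.1, x.2)).
Proof.
move=> /andP[ij jp]; apply/funext => x; apply/funext => l.
have il : (i < p.+3)%N by lia.
rewrite /face /prism /= inordK // /bump; have lp := ltn_ord l.
case: ifP => h1; case: ifP => h2; try lia;
  congr (H (hpair (x.1 _) _)); apply: val_inj; rewrite /= !inordK /bump; lia.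
Qed.

(** Beyond the jump the vertex i of the prism lies over s_(i-1), which is why the index of the face
    drops by one. *)
Lemma face_prism_gt p (i j : nat) : (j.+1 < i <= p.+2)%N ->
  face (inord i) \o @prism p.+1 j =
  @prism p j \o (fun x => (face (inord i.-1) x.1, x.2)).
Proof.
move=> /andP[ij jp]; apply/funext => x; apply/funext => l.
have il : (i < p.+3)%N by lia.
rewrite /face /prism /= inordK // /bump; have lp := ltn_ord l.
case: ifP => h1; case: ifP => h2; try lia;
  congr (H (hpair (x.1 _) _)); apply: val_inj; rewrite /= !inordK /bump; lia.
Qed.

Lemma face_prism_diag p (j : nat) : (j <= p)%N ->
  face (inord j) \o @prism p j = slice j.
Proof.
move=> jp; apply/funext => x; apply/funext => l.
rewrite /face /prism /slice /= inordK /bump; last by lia.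
have lp := ltn_ord l.
case: ifP => h1; case: ifP => h2; try lia;
  congr (H (hpair (x.1 _) _)); apply: val_inj; rewrite /= !inordK; lia.
Qed.

Lemma face_prism_diagS p (j : nat) : (j <= p)%N ->
  face (inord j.+1) \o @prism p j = slice j.+1.
Proof.
move=> jp; apply/funext => x; apply/funext => l.
rewrite /face /prism /slice /= inordK /bump; last by lia.
have lp := ltn_ord l.
case: ifP => h1; case: ifP => h2; try lia;
  congr (H (hpair (x.1 _) _)); apply: val_inj; rewrite /= !inordK; lia.
Qed.

Lemma face_prism_chain p (i : 'I_p.+2) j (c : microchain G cX p) :
  microchain_val (micro_push (@face_internal _ _ cY p i) (@face_micro _ _ cY p i)
    (prism_chain j c)) =
  push (cSK p) (simplex_coded cY p) (face i \o @prism p j) (cylinder (microchain_val c)).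
Proof.
have /asboolP hc := microchainP c.
exact: push_comp (@face_internal _ _ cY p i) (@prism_internal p j)
  (hyperfinite_sum_cylinder nK hc).
Qed.

(** As faces commute with cylinders, prisms of faces, like faces of prisms, become images of the one
    cylinder over [c]. Identities between chains thus reduce to identities between maps of
    simplices. *)
Lemma prism_chain_face p (i : 'I_p.+2) j (c : microchain G cX p.+1) :
  microchain_val (prism_chain j
    (micro_push (@face_internal _ _ cX p i) (@face_micro _ _ cX p i) c)) =
  push (cSK p.+1) (simplex_coded cY p.+1)
    (@prism p j \o (fun x => (face i x.1, x.2))) (cylinder (microchain_val c)).
Proof.
have /asboolP hc := microchainP c.
rewrite /= -(push_cylinder nK (face_internal cX i) hc).
apply: push_comp (hyperfinite_sum_cylinder nK hc); first exact: prism_internal.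
apply: internal_pair; last exact: internal_snd.
exact: (internal_comp (face_internal cX i) (internal_fst (cS p.+1) cK)).
Qed.

Let slice_chain p (c : microchain G cX p) (j : nat) :=
  push (cSK p) (simplex_coded cY p) (slice j) (cylinder (microchain_val c)).

Let val_sum p n (F : 'I_n -> microchain G cY p) (m : 'I_n -> int) :
  microchain_val (\sum_i F i *~ m i) = \sum_i microchain_val (F i) *~ m i.
Proof.
rewrite -[LHS]/(val _) raddf_sum; apply: eq_bigr => i _; exact: raddfMz.
Qed.

(** The face index passes through [inord] so that the summand is a function of natural numbers, as
    [prism_alternating_sum] requires. *)
Let val_boundary_prism p (c : microchain G cX p) :
  microchain_val (boundary (prism_sum c)) =
  \sum_(i < p.+2) \sum_(j < p.+1) microchain_val
    (micro_push (@face_internal _ _ cY p (inord i)) (@face_micro _ _ cY p (inord i))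
      (prism_chain j c)) *~ ((-1) ^+ j * (-1) ^+ i).
Proof.
rewrite /boundary /prism_sum val_sum; apply: eq_bigr => i _.
rewrite raddf_sum; under eq_bigr do rewrite raddfMz.
by rewrite val_sum mulrz_suml inord_val; apply: eq_bigr => j _; rewrite mulrzA.
Qed.

Lemma prism_boundary0 (c : microchain G cX 0) :
  microchain_val (boundary (prism_sum c)) = slice_chain c 0 - slice_chain c 1.
Proof.
rewrite val_boundary_prism.
(* In degree 0 the second double sum is empty and the conditions on [b] are vacuous, so the zero
   function serves. *)
rewrite -(@prism_alternating_sum _ 0 (fun i j => microchain_val
    (micro_push (@face_internal _ _ cY 0 (inord i)) (@face_micro _ _ cY 0 (inord i))
      (prism_chain j c))) (fun _ _ => 0) (slice_chain c)).
- by rewrite big_ord0 addr0.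
- by move=> i j ij; exfalso; lia.
- by move=> i j ij; exfalso; lia.
- by move=> j jp; rewrite face_prism_chain face_prism_diag.
- by move=> j jp; rewrite face_prism_chain face_prism_diagS.
Qed.

Lemma prism_boundary p (c : microchain G cX p.+1) :
  microchain_val (boundary (prism_sum c) + prism_sum (boundary c)) =
  slice_chain c 0 - slice_chain c p.+2.
Proof.
rewrite -[LHS]/(microchain_val (boundary (prism_sum c)) +
  microchain_val (prism_sum (boundary c))) val_boundary_prism.
rewrite -(@prism_alternating_sum _ p.+1 (fun i j => microchain_val
    (micro_push (@face_internal _ _ cY p.+1 (inord i))
      (@face_micro _ _ cY p.+1 (inord i)) (prism_chain j c)))
  (fun i j => microchain_val (prism_chain j
    (micro_push (@face_internal _ _ cX p (inord i))
      (@face_micro _ _ cX p (inord i)) c))) (slice_chain c)).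
- congr (_ + _); rewrite /prism_sum /boundary val_sum; apply: eq_bigr => j _.
  rewrite raddf_sum; under eq_bigr do rewrite raddfMz.
  rewrite val_sum mulrz_suml; apply: eq_bigr => i _.
  by rewrite inord_val mulrzA.
- by move=> i j ij; rewrite face_prism_chain prism_chain_face face_prism_lt.
- by move=> i j ij; rewrite face_prism_chain prism_chain_face face_prism_gt.
- by move=> j jp; rewrite face_prism_chain face_prism_diag.
- by move=> j jp; rewrite face_prism_chain face_prism_diagS.
Qed.

End Prism.

(** * The chain homotopy, absolute and relative *)

Section HomotopyOperator.
Context (N : nonstandard_universe) (G : zmod_in (intU N)) (R : realType).
Local Notation U := (stdU N).
Local Notation V := (intU N).
Local Notation hU := (pairing_standard (stdU_standard N)).
Local Notation hV := (pairing_intU N).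
Context (cI : coded U (unit_interval R)).
Context (X Y : uniformType) (cX : coded U X) (cY : coded U Y).

(** The operator is built from [H] alone, and the pair of subsets is quantified after it: the same
    operator gives the absolute homotopy and descends to the relative one. *)
Lemma homotopy_operator (f g : S_map cX cY)
    (H : S_map (prod_coded hU cX cI : coded U (X * unit_interval R)%type) cY) :
  S_homotopy f g H ->
  exists P : forall p, {additive mu_complex G cX p -> mu_complex G cY p.+1},
  [/\ forall c : mu_complex G cX 0,
        mu_map G g 0 c - mu_map G f 0 c = bdry (mu_complex G cY) (P 0%N c),
      forall p (c : mu_complex G cX p.+1),
        mu_map G g p.+1 c - mu_map G f p.+1 c =
        bdry (mu_complex G cY) (P p.+1 c) + P p (bdry (mu_complex G cX) c) &
      forall (A : set X) (B : set Y),
        (forall x t, hyper_set A x -> hyper_set B (H (hpair x t))) ->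
        forall p c, c \in mu_subcomplex G cX A p ->
          P p c \in mu_subcomplex G cY B p.+1].
Proof.
move=> [Hf Hg].
have [n [m [incl [shift [bot [top [t [nn [intl ints intt] [ji ti imi] [js bs ims]
  [tb tt tS]]]]]]]]] := subdivision_maps cI.
pose cK := elem_coded n.
pose P p := @prism_sum N G R cI X Y cX cY H _ cK nn _ _ (internal_comp intt intl)
  (internal_comp intt ints) tS p.
have ends p (c : microchain G cX p) :
    microchain_val (mu_map G g p c - mu_map G f p c) =
    push (prod_coded hV (simplex_coded cX p) cK) (simplex_coded cY p)
      (slice H (t \o incl) (t \o shift) 0) (cylinder (microchain_val c)) -
    push (prod_coded hV (simplex_coded cX p) cK) (simplex_coded cY p)
      (slice H (t \o incl) (t \o shift) p.+1) (cylinder (microchain_val c)).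
  (* The homotopy at the points of the subdivision: it is [f] at [bot] and [g] at [top], and along
     [shift] and [incl] it gives the two extreme slices, so the telescoping identity applies to
     it. *)
  pose psi (x : simplex cX p * elem m) : simplex cY p :=
    fun i => H (hpair (x.1 i) (t x.2)).
  have hpsi : internal (prod_coded hV (simplex_coded cX p) (elem_coded m))
      (simplex_coded cY p) psi.
    apply: (@internal_tuple N _ _ _ (hyper_coded cY) p (fun i x => psi x i)) => i.
    exact: internal_vertex.
  have /asboolP hc := microchainP c.
  have := push_cylinder_telescope (cK := cK) nn hc intl ints hpsi ji js ti bs imi ims.
  have -> : (fun x => psi (x, top)) = @simplex_map _ _ _ _ _ g p.
    by apply/funext => s; apply/funext => i; rewrite /psi /= tt Hg.
  have -> : (fun x => psi (x, bot)) = @simplex_map _ _ _ _ _ f p.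
    by apply/funext => s; apply/funext => i; rewrite /psi /= tb Hf.
  (* The other slice, at index 0, matches by computation, since i < 0 reduces to false. *)
  have -> : slice H (t \o incl) (t \o shift) p.+1 =
      fun x : simplex cX p * elem n => psi (x.1, incl x.2).
    by apply/funext => x; apply/funext => i; rewrite /slice ltn_ord.
  by move=> e; exact: esym e.
exists P; split=> [c|p c|A B HAB p c].
- by apply: microchain_inj; rewrite ends prism_boundary0.
- by apply: microchain_inj; rewrite ends prism_boundary.
- exact: prism_sum_in.
Qed.

End HomotopyOperator.

Theorem theorem11 (N : nonstandard_universe) (R : realType)
    (cI : coded (stdU N) (unit_interval R))
    (X Y : uniformType) (cX : coded (stdU N) X) (cY : coded (stdU N) Y)
    (G : zmod_in (intU N)) :
  (forall f g : S_map cX cY, S_homotopic cI f g ->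
     chain_homotopic (mu_map G f) (mu_map G g) /\
     forall p, homology_map (mu_map G f) p =1 homology_map (mu_map G g) p) /\
  (forall (A : set X) (B : set Y) (f g : S_map cX cY)
     (fAB : maps_pair A B f) (gAB : maps_pair A B g),
     S_homotopic_pair cI A B f g ->
     chain_homotopic (mu_map_relative G fAB) (mu_map_relative G gAB) /\
     forall p, homology_map (mu_map_relative G fAB) p =1
               homology_map (mu_map_relative G gAB) p).
Proof.
split=> [f g [H fgH]|A B f g fAB gAB [H fgH HAB]].
  have [P [P0 PS _]] := homotopy_operator G fgH.
  have fg : chain_homotopic (mu_map G f) (mu_map G g) by exists P.
  by split=> // p; exact: homology_map_homotopic.
have [P [P0 PS PAB]] := homotopy_operator G fgH.
have fg : chain_homotopic (mu_map_relative G fAB) (mu_map_relative G gAB).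
  exact: quotient_chain_homotopic (PAB _ _ HAB) P0 PS.
by split=> // p; exact: homology_map_homotopic.
Qed.
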